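(* Let $n\ge 1$. The standard effective $T^{n+1}$-action on the complex Grassmannian $G_{2}(\mathbb{C}^{n+2})$ is maximal among the effective torus actions which preserve the almost complex structure; that is, there is no effective action of a torus $T^{\ell}$ with $\ell>n+1$ on $G_2(\mathbb{C}^{n+2})$ which preserves the standard complex structure and extends the standard $T^{n+1}$-action.
   Context: $G_2(\mathbb{C}^{n+2})$ is the set of complex 2-dimensional linear subspaces of $\mathbb{C}^{n+2}$, a compact complex manifold of complex dimension $2n$, with its standard complex structure. The standard effective $T^{n+1}$-action on it is the one induced from the action of $T^{n+1}$ on $\mathbb{C}^{n+2}$ by coordinatewise multiplication on the first $n+1$ coordinates (trivial on the last coordinate). Actions are smooth. An effective $T^{\ell}$-action $\varphi'$ on $M$ extends an effective $T^{k}$-action $\varphi$ on $M$ ($k<\ell$) if there is an injective homomorphism $\iota:T^{k}\to T^{\ell}$ with $\varphi'(\iota(t),x)=\varphi(t,x)$ for all $t\in T^k$, $x\in M$. *)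

(* Defs.v *)
From HB Require Import structures.
From mathcomp Require Import all_boot all_order all_algebra all_fingroup.
From mathcomp Require Import all_classical all_reals all_analysis.
From mathcomp Require Import complex.

Set Implicit Arguments.
Unset Strict Implicit.
Unset Printing Implicit Defensive.

Import Order.TTheory GRing.Theory Num.Theory.
Import numFieldNormedType.Exports.

Local Open Scope classical_set_scope.
Local Open Scope ring_scope.
Local Open Scope complex_scope.

(* f is of class C^k on the open set U. Between finite-dimensional spaces (the
   only use below) f is C^(k+1) iff it is differentiable and all its
   directional derivatives are C^k. *)
Fixpoint class_C (R : realType) (V W : normedModType R) (k : nat)
    (U : set V) (f : V -> W) : Prop :=
  match k with
  | 0 => forall x, U x -> {for x, continuous f}
  | k'.+1 => (forall x, U x -> differentiable f x) /\
             (forall v, class_C k' U ('D_v f))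
  end.

Definition smooth_on (R : realType) (V W : normedModType R)
    (U : set V) (f : V -> W) : Prop := forall k, class_C k U f.

(* T^l = (S^1)^l *)
Record torus (R : realType) (l : nat) := Torus {
  tval : 'rV[R[i]]_l;
  tvalP : [forall j, `|tval 0 j| == 1] }.

HB.instance Definition _ (R : realType) (l : nat) :=
  [isSub for @tval R l].
HB.instance Definition _ (R : realType) (l : nat) :=
  [Choice of torus R l by <:].

Section TorusGroup.
Variables (R : realType) (l : nat).
Implicit Types t u : torus R l.

Lemma torus_norm t j : `|tval t 0 j| = 1.
Proof. by apply/eqP; move/forallP: (tvalP t). Qed.

Fact torus_one_subproof : [forall j, `|(const_mx 1 : 'rV[R[i]]_l) 0 j| == 1].
Proof. by apply/forallP => j; rewrite mxE normr1. Qed.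

Fact torus_inv_subproof t :
  [forall j, `|(\row_j' (tval t 0 j')^-1 : 'rV[R[i]]_l) 0 j| == 1].
Proof. by apply/forallP => j; rewrite mxE normfV torus_norm invr1. Qed.

Fact torus_mul_subproof t u :
  [forall j, `|(\row_j' (tval t 0 j' * tval u 0 j') : 'rV[R[i]]_l) 0 j| == 1].
Proof. by apply/forallP => j; rewrite mxE normrM !torus_norm mulr1. Qed.

Definition torus_one := Torus torus_one_subproof.
Definition torus_inv t := Torus (torus_inv_subproof t).
Definition torus_mul t u := Torus (torus_mul_subproof t u).

Lemma torus_neq0 t j : tval t 0 j != 0.
Proof. by rewrite -normr_gt0 torus_norm ltr01. Qed.

Fact torus_mulA : associative torus_mul.
Proof. by move=> t u v; apply/val_inj/rowP => j /=; rewrite !mxE mulrA. Qed.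
Fact torus_mul1 : left_id torus_one torus_mul.
Proof. by move=> t; apply/val_inj/rowP => j /=; rewrite !mxE mul1r. Qed.
Fact torus_mulr1 : right_id torus_one torus_mul.
Proof. by move=> t; apply/val_inj/rowP => j /=; rewrite !mxE mulr1. Qed.
Fact torus_mulV : left_inverse torus_one torus_inv torus_mul.
Proof.
by move=> t; apply/val_inj/rowP => j /=; rewrite !mxE mulVf ?torus_neq0.
Qed.
Fact torus_mulrV : right_inverse torus_one torus_inv torus_mul.
Proof.
by move=> t; apply/val_inj/rowP => j /=; rewrite !mxE mulfV ?torus_neq0.
Qed.

HB.instance Definition _ := isGroup.Build (torus R l)
  torus_mulA torus_mul1 torus_mulr1 torus_mulV torus_mulrV.

Fact torus_exp_subproof (a : 'rV[R]_l) :
  [forall j, `|(\row_j' (cos (a 0 j') +i* sin (a 0 j')) : 'rV[R[i]]_l) 0 j|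
             == 1].
Proof.
by apply/forallP => j; rewrite mxE normc_def /= cos2Dsin2 sqrtr1 /= eqxx.
Qed.

(* The covering R^l -> T^l, a |-> (e^(i a_j))_j; it is a local diffeomorphism,
   through which the smooth structure of T^l is expressed. *)
Definition torus_exp (a : 'rV[R]_l) : torus R l :=
  Torus (torus_exp_subproof a).

End TorusGroup.

(* G_2(C^(n+2)); equality of {vspace _} is equality of subspaces. *)
Definition grass2 (R : realType) (n : nat) :=
  {V : {vspace 'rV[R[i]]_(n.+2)} | \dim V == 2%N}.

Section Charts.
Variables (R : realType) (n : nat).

(* C^(2 x n) as pairs (real part, imaginary part). *)
Definition model : Type := ('M[R]_(2, n) * 'M[R]_(2, n))%type.
HB.instance Definition _ := NormedModule.on model.

Definition model_complex (p : model) : 'M[R[i]]_(2, n) :=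
  \matrix_(i, j) (p.1 i j +i* p.2 i j).

Definition model_J (p : model) : model := (- p.2, p.1).

Definition chart_mx (s : 'S_(n.+2)) (z : 'M[R[i]]_(2, n)) :
    'M[R[i]]_(2, n.+2) :=
  col_perm s (@row_mx _ 2 2 n 1%:M z).

Definition chart_lin (s : 'S_(n.+2)) (z : 'M[R[i]]_(2, n)) :
    'Hom('rV[R[i]]_2, 'rV[R[i]]_(n.+2)) :=
  linfun (mulmxr (chart_mx s z)).

Fact chart_subproof s z :
  \dim (chart_lin s z @: fullv)%VS == 2%N.
Proof.
rewrite limg_dim_eq ?dimvf //; apply/eqP; rewrite -subv0; apply/subvP => c.
rewrite memv_cap memvf /= memv_ker lfunE /= memv0 => /eqP e.
have : c *m @row_mx _ 2 2 n 1%:M z = 0.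
  apply/rowP => j; have /rowP/(_ ((s^-1)%g j)) ej := e.
  rewrite [RHS]mxE in ej; rewrite [RHS]mxE -ej [LHS]mxE [RHS]mxE.
  by apply: eq_bigr => k _; rewrite [in RHS]mxE permKV.
by rewrite mul_mx_row mulmx1 -row_mx0 => /eq_row_mx [-> _].
Qed.

(* Inverses of the standard holomorphic charts: the row space of (1 | z) with
   its columns permuted by s. The images for all s cover grass2, and the image
   for s depends only on which two columns carry the identity block. *)
Definition chart (s : 'S_(n.+2)) (p : model) : grass2 R n :=
  @exist _ (fun V => \dim V == 2%N) _ (chart_subproof s (model_complex p)).

End Charts.

Section Actions.
Variables (R : realType) (n : nat).

(* The real differential of F commutes with the standard complex structure J at
   every point: g is the expression of F in charts around chart s p and
   F (chart s p). *)
Definition preserves_J (F : grass2 R n -> grass2 R n) : Prop :=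
  forall (s : 'S_(n.+2)) (p : model R n),
  exists (s' : 'S_(n.+2)) (g : model R n -> model R n),
    [/\ \forall q \near p, F (chart s q) = chart s' (g q),
        differentiable g p &
        forall v, 'd g p (model_J v) = model_J ('d g p v)].

Variable l : nat.
Implicit Type phi : torus R l -> grass2 R n -> grass2 R n.

Definition is_action phi : Prop :=
  (forall x, phi 1%g x = x) /\
  (forall t u x, phi (t * u)%g x = phi t (phi u x)).

(* Smoothness of the map T^l x M -> M, in local coordinates. *)
Definition smooth_action phi : Prop :=
  forall (a : 'rV[R]_l) (s : 'S_(n.+2)) (p : model R n),
  exists (s' : 'S_(n.+2)) (U : set ('rV[R]_l * model R n)%type)
         (g : ('rV[R]_l * model R n)%type -> model R n),
    [/\ open_nbhs (a, p) U,
        forall q, U q -> phi (torus_exp q.1) (chart s q.2) = chart s' (g q) &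
        smooth_on U g].

Definition effective phi : Prop :=
  forall t, (forall x, phi t x = x) -> t = 1%g.

Definition effective_torus_action phi : Prop :=
  [/\ is_action phi, smooth_action phi & effective phi].

Definition action_preserves_J phi : Prop := forall t, preserves_J (phi t).

End Actions.

Definition extends (R : realType) (n k l : nat)
    (phi' : torus R l -> grass2 R n -> grass2 R n)
    (phi : torus R k -> grass2 R n -> grass2 R n) : Prop :=
  exists iota : {multiplicative torus R k -> torus R l},
    injective iota /\ forall t x, phi' (iota t) x = phi t x.

Section StandardAction.
Variables (R : realType) (n : nat).

Definition std_weight (t : torus R n.+1) : 'rV[R[i]]_(n.+2) :=
  \row_j (if unlift ord_max j is Some i then tval t 0 i else 1).

Definition std_lin (t : torus R n.+1) :
    'Hom('rV[R[i]]_(n.+2), 'rV[R[i]]_(n.+2)) :=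
  linfun (mulmxr (diag_mx (std_weight t))).

Fact std_action_subproof (t : torus R n.+1) (V : grass2 R n) :
  \dim (std_lin t @: val V)%VS == 2%N.
Proof.
rewrite limg_dim_eq ?(eqP (valP V)) //.
apply/eqP; rewrite -subv0; apply/subvP => v.
rewrite memv_cap memv_ker lfunE /= memv0 => /andP[_ /eqP e].
apply/eqP/rowP => j; have /rowP/(_ j) := e.
rewrite mul_mx_diag !mxE => /eqP; rewrite mulf_eq0.
case: unliftP => [i _|_]; last by rewrite oner_eq0 orbF => /eqP.
by rewrite (negPf (torus_neq0 t i)) orbF => /eqP.
Qed.

(* t . V is the image of V under (v_0, ..., v_(n+1)) |->
   (t_0 v_0, ..., t_n v_n, v_(n+1)). *)
Definition std_action (t : torus R n.+1) (V : grass2 R n) : grass2 R n :=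
  @exist _ (fun V => \dim V == 2%N) _ (std_action_subproof t V).

End StandardAction.

(* Main.v *)
(* Let phi be a holomorphic T^l-action extending the standard one and let F be
   phi(t) for a 2-torsion element t. F commutes with the standard torus T and, as
   t lies on a one-parameter subgroup, fixes every coordinate plane: its orbit
   stays among the fixed points of T, which are isolated. Because the
   differential of F is complex linear, F also commutes with the real dilations
   diag(e^(w_k u)) generated by i Lie(T). Each chart is centred at a coordinate
   plane and one of these dilations is the homothety of the chart, so F is
   homogeneous and differentiable at 0, hence linear; T-equivariance makes it
   diagonal, with entries +-1 since F^2 = 1. Since F preserves every chart it
   preserves the vanishing of each Pluecker coordinate, which forces the matrix of
   diagonal entries to have rank one; thus F is a 2-torsion element of T. So the
   2-torsion of T^l, of order 2^l, comes from that of T^(n+1), and l <= n+1. *)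

From HB Require Import structures.
From mathcomp Require Import all_boot all_order all_algebra all_fingroup.
From mathcomp Require Import all_classical all_reals all_analysis.
From mathcomp Require Import complex ring.
Require Import Defs.

Set Implicit Arguments.
Unset Strict Implicit.
Unset Printing Implicit Defensive.

Import Order.TTheory GRing.Theory Num.Theory.
Import numFieldNormedType.Exports.

Local Open Scope classical_set_scope.
Local Open Scope ring_scope.
Local Open Scope complex_scope.

(** * Pluecker coordinates and charts *)

Section Plucker.
Variables (R : realType) (n : nat).
Local Notation C := (R[i]).
Implicit Types (A B : 'M[C]_(2, n.+2)) (s : 'S_(n.+2)) (Z : 'M[C]_(2, n)) (V W : grass2 R n).

Definition rowspan B : {vspace 'rV[C]_(n.+2)} :=
  (linfun (mulmxr B) @: fullv)%VS.

Definition minor2 B a b : C := B 0 a * B 1 b - B 0 b * B 1 a.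

(** The charts parametrised by complex matrices, so that the algebra takes place over C; [chart] and
    [model] serve the real calculus. *)
Definition cchart s Z : grass2 R n :=
  @exist _ (fun U => \dim U == 2%N) _ (chart_subproof s Z).

Lemma chartE s p : chart s p = cchart s (model_complex p).
Proof. by []. Qed.

Lemma val_cchart s Z : val (cchart s Z) = rowspan (chart_mx s Z).
Proof. by []. Qed.

Lemma mem_rowspan v B : reflect (exists c, v = c *m B) (v \in rowspan B).
Proof.
apply: (iffP memv_imgP) => [[c _ ->]|[c ->]].
  by exists c; rewrite lfunE.
by exists c; rewrite ?memvf ?lfunE.
Qed.

Lemma rowspan_mulmx Q B : Q \in unitmx -> rowspan (Q *m B) = rowspan B.
Proof.
move=> Qu; apply/vspaceP => v; apply/mem_rowspan/mem_rowspan => -[c ->].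
  by exists (c *m Q); rewrite mulmxA.
by exists (c *m invmx Q); rewrite mulmxA mulmxKV.
Qed.

Lemma ord2P (P : 'I_2 -> Prop) : P 0 -> P 1 -> forall i, P i.
Proof.
move=> P0 P1 [[|[|//]] Hi].
  by rewrite (_ : Ordinal Hi = 0) //; apply: val_inj.
by rewrite (_ : Ordinal Hi = 1) //; apply: val_inj.
Qed.

Lemma mulmx2E m k (A : 'M[C]_(m, 2)) (B : 'M[C]_(2, k)) i j :
  (A *m B) i j = A i 0 * B 0 j + A i 1 * B 1 j.
Proof.
rewrite mxE big_ord_recl big_ord1; congr (_ + A i _ * B _ j); exact: val_inj.
Qed.

Lemma det_mx2 (Q : 'M[C]_2) : \det Q = Q 0 0 * Q 1 1 - Q 0 1 * Q 1 0.
Proof.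
rewrite (expand_det_row Q 0) big_ord_recl big_ord1 /cofactor !det_mx11 !mxE.
rewrite /= expr0 expr1 mul1r mulN1r mulrN; congr (Q _ _ * Q _ _ - Q _ _ * Q _ _); exact: val_inj.
Qed.

(** The rows of [A] are combinations of the rows of [B], and [k] is the determinant of the 2 x 2
    matrix of coefficients. *)
Lemma minor2_rowspan A B : rowspan A = rowspan B ->
  exists k, forall a b, minor2 A a b = k * minor2 B a b.
Proof.
move=> AB; have rowA i : exists c, row i A = c *m B.
  by apply/mem_rowspan; rewrite -AB; apply/mem_rowspan; exists (delta_mx 0 i);
     rewrite rowE.
have [c0 e0] := rowA 0; have [c1 e1] := rowA 1.
exists (c0 0 0 * c1 0 1 - c0 0 1 * c1 0 0) => a b.
have E0 j : A 0 j = c0 0 0 * B 0 j + c0 0 1 * B 1 j.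
  by rewrite -mulmx2E -e0 mxE.
have E1 j : A 1 j = c1 0 0 * B 0 j + c1 0 1 * B 1 j.
  by rewrite -mulmx2E -e1 mxE.
rewrite /minor2 !E0 !E1; ring.
Qed.

(** [col_perm s] puts column [s k] of (1 | Z) at position [k]; hence the inverse permutation locates
    the identity columns ([lcol]) and the columns of Z ([rcol]). *)
Local Notation lcol s i := ((s^-1)%g (@lshift 2 n i)).
Local Notation rcol s j := ((s^-1)%g (@rshift 2 n j)).

Lemma chart_mxl s Z i k : chart_mx s Z i (lcol s k) = (i == k)%:R.
Proof.
rewrite mxE permKV; transitivity ((1%:M : 'M[C]_2) i k); last by rewrite mxE.
exact: row_mxEl.
Qed.

Lemma chart_mxr s Z i k : chart_mx s Z i (rcol s k) = Z i k.
Proof. by rewrite mxE permKV; exact: row_mxEr. Qed.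

Lemma colP s (P : 'I_(n.+2) -> Prop) :
  (forall i, P (lcol s i)) -> (forall j, P (rcol s j)) -> forall k, P k.
Proof.
move=> Pl Pr k; rewrite -(permK s k).
by have [i ->|j ->] := @split_ordP 2 n (s k).
Qed.

Lemma minor2_chart s Z : minor2 (chart_mx s Z) (lcol s 0) (lcol s 1) = 1.
Proof. by rewrite /minor2 !chart_mxl /= mulr0 subr0 mulr1. Qed.

Lemma minor2_chart0 s Z j :
  minor2 (chart_mx s Z) (rcol s j) (lcol s 1) = Z 0 j.
Proof. by rewrite /minor2 !chart_mxl !chart_mxr /= mul0r subr0 mulr1. Qed.

Lemma minor2_chart1 s Z j :
  minor2 (chart_mx s Z) (lcol s 0) (rcol s j) = Z 1 j.
Proof. by rewrite /minor2 !chart_mxl !chart_mxr /= mulr0 subr0 mul1r. Qed.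

(** Every entry of Z is a minor of the chart matrix, and the minor of the identity columns, equal to
    1 on both sides, forces the proportionality factor to be 1. *)
Lemma cchart_inj s : injective (cchart s).
Proof.
move=> Z Y /(congr1 val); rewrite !val_cchart => /minor2_rowspan[k e].
have := e (lcol s 0) (lcol s 1); rewrite !minor2_chart mulr1 => k1.
apply/matrixP => i j; move: i; apply: ord2P.
  by rewrite -!(minor2_chart0 s) e -k1 mul1r.
by rewrite -!(minor2_chart1 s) e -k1 mul1r.
Qed.

(** Cramer's rule for the columns [rcol s j] of Q^-1 B, where Q is the block of [B] in the columns
    [lcol s 0], [lcol s 1]. *)
Definition chart_coord s B : 'M[C]_(2, n) :=
  \matrix_(i, j) ((if i == 0 then minor2 B (rcol s j) (lcol s 1)
                   else minor2 B (lcol s 0) (rcol s j)) /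
                  minor2 B (lcol s 0) (lcol s 1)).

Lemma rowspan_chart s B : minor2 B (lcol s 0) (lcol s 1) != 0 ->
  rowspan B = rowspan (chart_mx s (chart_coord s B)).
Proof.
move=> nz; pose Q : 'M[C]_2 := \matrix_(i, k) B i (lcol s k).
suff e : B = Q *m chart_mx s (chart_coord s B).
  rewrite {1}e rowspan_mulmx //.
  by rewrite unitmxE unitfE det_mx2 !mxE; move: nz; rewrite /minor2.
apply/matrixP => i k; rewrite mulmx2E; move: k.
apply: (@colP s) => [|j].
  by apply: ord2P; rewrite !chart_mxl !mxE /= ?mulr0 ?mulr1 ?addr0 ?add0r.
rewrite !chart_mxr !mxE /=; move: nz; rewrite /minor2 => nz.
by move: i; apply: ord2P; field.
Qed.

Lemma perm_pair (a b : 'I_(n.+2)) : a != b ->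
  exists s : 'S_(n.+2), lcol s 0 = a /\ lcol s 1 = b.
Proof.
move=> ab; pose o0 : 'I_(n.+2) := @lshift 2 n 0; pose o1 : 'I_(n.+2) := @lshift 2 n 1.
pose b' := tperm o0 a b.
have b'0 : b' != o0.
  by rewrite -(inj_eq (@perm_inj _ (tperm o0 a))) tpermK tpermL eq_sym.
(* The first transposition leaves [o0] alone because [b'] differs from it, and sends [o1] to [b'],
   which the second one carries to [b]. *)
exists ((tperm o1 b' * tperm o0 a)^-1)%g; rewrite invgK !permM; split.
  by rewrite (@tpermD _ o1) ?tpermL // eq_sym.
by rewrite tpermL tpermK.
Qed.

Lemma eq_cchart s B V : val V = rowspan B ->
  minor2 B (lcol s 0) (lcol s 1) != 0 -> V = cchart s (chart_coord s B).
Proof. by move=> eV nz; apply: val_inj; rewrite eV; exact: rowspan_chart. Qed.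

Lemma grass2_basis (V : grass2 R n) : exists B,
  val V = rowspan B /\ forall c : 'rV_2, c *m B = 0 -> c = 0.
Proof.
have [X bX] : exists X : 2.-tuple _, basis_of (val V) X.
  move: (val V) (eqP (valP V)) => U <-.
  by exists (vbasis U); exact: vbasisP.
have lin (c : 'rV[C]_2) : c *m (\matrix_(i < 2) X`_i) = \sum_i c 0 i *: X`_i.
  by rewrite mulmx_sum_row; apply: eq_bigr => i _; rewrite rowK.
exists (\matrix_(i < 2) X`_i); split.
  apply/vspaceP => v; apply/idP/mem_rowspan => [vV|[c ->]].
    exists (\row_i coord X i v); rewrite lin {1}(coord_basis bX vV).
    by apply: eq_bigr => i _; rewrite mxE.
  rewrite lin; apply: memv_suml => i _; apply: memvZ.
  by apply: (basis_mem bX); rewrite mem_nth ?size_tuple.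
move=> c; rewrite lin; have /freeP fX := basis_free bX.
move=> /fX c0.
by apply/rowP => i; rewrite c0 mxE.
Qed.

Definition basis_mx V := projT1 (cid (grass2_basis V)).

Lemma rowspan_basis_mx V : rowspan (basis_mx V) = val V.
Proof. by rewrite /basis_mx; case: cid => B []. Qed.

Lemma minor2_neq0 V B : val V = rowspan B -> exists a b, minor2 B a b != 0.
Proof.
have [A [-> freeA]] := grass2_basis V.
move=> /esym BA; apply: contrapT => /forallNP nB.
have zA a b : minor2 A a b = 0.
  have [k ->] := minor2_rowspan (esym BA).
  move/forallNP: (nB a) => /(_ b)/negP; rewrite negbK => /eqP ->.
  by rewrite mulr0.
have A0 i k : A i k = 0.
  (* With these coefficients the combination of the rows of [A] has the minors involving column [k]
     as entries, so it vanishes and independence kills the coefficients. *)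
  have e1 : \row_(i < 2) (if i == 0 then A 1 k else - A 0 k) = 0 :> 'rV[C]_2.
    apply: freeA; apply/rowP => b; rewrite mulmx2E !mxE /= mulNr -(zA b k) /minor2.
    by ring.
  have e (j : 'I_2) : (if j == 0 then A 1 k else - A 0 k) = 0.
    by have := congr1 (fun M : 'rV[C]_2 => M 0 j) e1; rewrite !mxE.
  have := e 0; have := e 1; rewrite /= => /eqP; rewrite oppr_eq0 => /eqP e0 {}e1.
  by move: i; apply: ord2P.
have : (const_mx 1 : 'rV[C]_2) = 0.
  by apply: freeA; apply/rowP => b; rewrite mulmx2E !A0 !mulr0 addr0 mxE.
by move/rowP/(_ 0)/eqP; rewrite !mxE oner_eq0.
Qed.

Lemma minor2xx B a : minor2 B a a = 0.
Proof. by rewrite /minor2; ring. Qed.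

Lemma cchart_cover V : exists s Z, V = cchart s Z.
Proof.
have eV := esym (rowspan_basis_mx V).
have [a [b nz]] := minor2_neq0 eV.
have ab : a != b by apply: contraNneq nz => ->; rewrite minor2xx.
have [s [ea eb]] := perm_pair ab.
exists s, (chart_coord s (basis_mx V)); apply: eq_cchart => //.
by rewrite ea eb.
Qed.

Definition model_of (Z : 'M[C]_(2, n)) : model R n :=
  (map_mx (@complex.Re R) Z, map_mx (@complex.Im R) Z).

Lemma model_ofK : cancel model_of (@model_complex R n).
Proof. by move=> Z; apply/matrixP => i j; rewrite !mxE /=; case: (Z i j). Qed.

Lemma model_complexK : cancel (@model_complex R n) model_of.
Proof.
by case=> x y; congr (_, _); apply/matrixP => i j; rewrite !mxE.
Qed.

Lemma chart_cover V : exists s p, V = chart s p.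
Proof.
have [s [Z ->]] := cchart_cover V.
by exists s, (model_of Z); rewrite chartE model_ofK.
Qed.

(* The entries of the rank one projector p p^* / |p|^2, p being the vector of
   Pluecker coordinates. *)
Definition pluck_proj V a b c d : C :=
  minor2 (basis_mx V) a b * conjc (minor2 (basis_mx V) c d) /
  \sum_i \sum_j minor2 (basis_mx V) i j * conjc (minor2 (basis_mx V) i j).

Lemma minor2_sum_neq0 V B : val V = rowspan B ->
  \sum_i \sum_j minor2 B i j * conjc (minor2 B i j) != 0.
Proof.
move=> eV; have [a [b nz]] := minor2_neq0 eV; apply: contraNneq nz => z.
have ge0 i j : 0 <= minor2 B i j * conjc (minor2 B i j) by exact: mul_conjC_ge0.
have z1 := psumr_eq0P (fun i _ => sumr_ge0 _ (fun j _ => ge0 i j)) z.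
have /psumr_eq0P := z1 a isT => /(_ (fun j _ => ge0 a j) b isT)/eqP.
by rewrite mulf_eq0 conjc_eq0 orbb.
Qed.

(** A change of basis multiplies all minors by one [k], so numerator and denominator both pick up
    [k * conjc k]. *)
Lemma pluck_projE V B a b c d : val V = rowspan B -> pluck_proj V a b c d =
  minor2 B a b * conjc (minor2 B c d) /
  \sum_i \sum_j minor2 B i j * conjc (minor2 B i j).
Proof.
move=> eV; rewrite /pluck_proj.
have [|k ek] := @minor2_rowspan (basis_mx V) B; first by rewrite rowspan_basis_mx.
have := minor2_sum_neq0 (esym (rowspan_basis_mx V)).
have -> : \sum_i \sum_j minor2 (basis_mx V) i j * conjc (minor2 (basis_mx V) i j) =
  k * conjc k * \sum_i \sum_j minor2 B i j * conjc (minor2 B i j).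
  rewrite big_distrr; apply: eq_bigr => i _; rewrite big_distrr.
  by apply: eq_bigr => j _ /=; rewrite !ek rmorphM /=; ring.
rewrite !ek rmorphM /=; move: (\sum_i _) => S; rewrite !mulf_eq0 conjc_eq0.
rewrite !negb_or => /andP[/andP[k0 _] S0].
have k'0 : conjc k != 0 by rewrite conjc_eq0.
by field; rewrite S0 k'0.
Qed.

(** Fixing the second pair of indices at the identity columns of a chart around [V] shows the minors
    of [V] and [W] to be proportional; chart coordinates are ratios of minors. *)
Lemma pluck_proj_inj V W :
  (forall a b c d, pluck_proj V a b c d = pluck_proj W a b c d) -> V = W.
Proof.
move=> VW; have [s [Z eV]] := cchart_cover V; rewrite eV.
set a := lcol s 0; set b := lcol s 1.
pose B := basis_mx W; have eW := esym (rowspan_basis_mx W).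
have eV' : val V = rowspan (chart_mx s Z) by rewrite eV.
have SV0 := minor2_sum_neq0 eV'.
have SW0 := minor2_sum_neq0 eW.
have E c d : minor2 (chart_mx s Z) c d =
  minor2 B c d * (conjc (minor2 B a b) *
  (\sum_i \sum_j minor2 (chart_mx s Z) i j * conjc (minor2 (chart_mx s Z) i j))
  / (\sum_i \sum_j minor2 B i j * conjc (minor2 B i j))).
  have := VW c d a b; rewrite (pluck_projE _ _ _ _ eV') (pluck_projE _ _ _ _ eW).
  rewrite minor2_chart conjc1 mulr1 -/B => /(congr1 ( *%R^~
   (\sum_i \sum_j minor2 (chart_mx s Z) i j * conjc (minor2 (chart_mx s Z) i j)))).
  by rewrite mulfVK // => ->; ring.
have {E} [k E] : exists k, forall c d, minor2 (chart_mx s Z) c d = minor2 B c d * k.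
  by eexists.
have Bk : minor2 B a b * k = 1 by rewrite -E minor2_chart.
have nz : minor2 B a b != 0.
  by apply: contraTneq (oner_neq0 C) => z; rewrite -Bk z mul0r eqxx.
rewrite (eq_cchart eW nz); congr cchart; apply/matrixP => i j.
have ek : (minor2 B a b)^-1 = k.
  by apply: (mulfI nz); rewrite Bk divff.
rewrite mxE -/a -/b -/B ek; move: i; apply: ord2P => /=; rewrite -E.
  by rewrite minor2_chart0.
by rewrite minor2_chart1.
Qed.

(** * Diagonal matrices acting on the Grassmannian *)

Definition diag_unit (d : 'rV[C]_(n.+2)) := forall k, d 0 k != 0.

(** [insubd] makes this total in [d]: the default [V] is returned when the image is not a plane,
    which does not occur under [diag_unit d]. *)
Definition gact (d : 'rV[C]_(n.+2)) (V : grass2 R n) : grass2 R n :=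
  insubd V (linfun (mulmxr (diag_mx d)) @: val V)%VS.

(** Chart expression of [gact d]: after the columns are scaled, dividing row [i] by the entry of [d]
    at [lcol s i] restores the identity block. *)
Definition wt s (d : 'rV[C]_(n.+2)) Z : 'M[C]_(2, n) :=
  \matrix_(i, j) (d 0 (rcol s j) / d 0 (lcol s i) * Z i j).

Lemma limg_diag d B :
  (linfun (mulmxr (diag_mx d)) @: rowspan B)%VS = rowspan (B *m diag_mx d).
Proof.
apply/vspaceP => v; apply/memv_imgP/mem_rowspan.
  by case=> w /mem_rowspan[c ->] ->; exists c; rewrite lfunE /= mulmxA.
by case=> c ->; exists (c *m B); rewrite ?lfunE /= ?mulmxA //;
   apply/mem_rowspan; exists c.
Qed.

Lemma rowspan_chart_diag s d Z : diag_unit d ->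
  rowspan (chart_mx s Z *m diag_mx d) = rowspan (chart_mx s (wt s d Z)).
Proof.
move=> du; pose Q : 'M[C]_2 := diag_mx (\row_i d 0 (lcol s i)).
suff -> : chart_mx s Z *m diag_mx d = Q *m chart_mx s (wt s d Z).
  rewrite rowspan_mulmx // unitmxE unitfE det_diag.
  by apply/prodf_neq0 => i _; rewrite mxE.
apply/matrixP => i k; rewrite mul_mx_diag mul_diag_mx [LHS]mxE [RHS]mxE [in RHS]mxE.
move: k; apply: (@colP s) => j.
  by rewrite !chart_mxl; case: eqP => [->|_]; rewrite ?mulr1 ?mul1r ?mulr0 ?mul0r.
by rewrite !chart_mxr mxE; field.
Qed.

Lemma gact_cchart s d Z : diag_unit d -> gact d (cchart s Z) = cchart s (wt s d Z).
Proof.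
move=> du; apply: val_inj; rewrite /gact val_insubd limg_diag val_cchart.
by rewrite rowspan_chart_diag // -[rowspan _](val_cchart) (valP (cchart s _)).
Qed.

Lemma gactM d e V : diag_unit d -> diag_unit e ->
  gact d (gact e V) = gact (\row_k (d 0 k * e 0 k)) V.
Proof.
move=> du eu; have [s [Z ->]] := cchart_cover V.
rewrite !gact_cchart //; last by move=> k; rewrite mxE mulf_neq0.
congr cchart; apply/matrixP => i j; rewrite !mxE invfM; ring.
Qed.

Lemma gact_const c V : c != 0 -> gact (const_mx c) V = V.
Proof.
move=> c0; have [s [Z ->]] := cchart_cover V.
rewrite gact_cchart => [|k]; last by rewrite mxE.
by congr cchart; apply/matrixP => i j; rewrite !mxE divff // mul1r.
Qed.

Lemma gactZ c d V : c != 0 -> diag_unit d -> gact (c *: d) V = gact d V.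
Proof.
move=> c0 du; rewrite -[RHS](gact_const _ c0) gactM // => [|k]; last by rewrite mxE.
by congr gact; apply/rowP => k; rewrite !mxE.
Qed.

End Plucker.

Notation lcol s i := ((s^-1)%g (@lshift 2 _ i)).
Notation rcol s j := ((s^-1)%g (@rshift 2 _ j)).

(** * The standard action *)

(* The chart expression of the standard action lies in a class of maps closed
   under directional derivatives, hence is smooth. *)
Section TrigPoly.
Variables (R : realType) (V : normedModType R).

Inductive trigpoly : (V -> R) -> Prop :=
| trigpoly_cst c : trigpoly (cst c)
| trigpoly_lin (f : {linear V -> R}) : continuous f -> trigpoly f
| trigpoly_add f g : trigpoly f -> trigpoly g -> trigpoly (f + g)
| trigpoly_mul f g : trigpoly f -> trigpoly g -> trigpoly (f * g)
| trigpoly_cos f : trigpoly f -> trigpoly (cos \o f)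
| trigpoly_sin f : trigpoly f -> trigpoly (sin \o f).

Lemma trigpoly_linear (f : V -> R) : linear f -> continuous f -> trigpoly f.
Proof.
move=> lf cf; pose F : {linear V -> R} := HB.pack f (GRing.isLinear.Build _ _ _ _ f lf).
exact: (@trigpoly_lin F).
Qed.

Lemma trigpoly_opp f : trigpoly f -> trigpoly (- f).
Proof.
move=> tf; have -> : - f = cst (-1) * f by apply/funext => x; rewrite /= mulN1r.
exact/trigpoly_mul/tf/trigpoly_cst.
Qed.

Lemma differentiable_cos (x : R) : differentiable (cos : R -> R) x.
Proof. exact/derivable1_diffP/derivable_cos. Qed.

Lemma differentiable_sin (x : R) : differentiable (sin : R -> R) x.
Proof. exact/derivable1_diffP/derivable_sin. Qed.

Lemma trigpoly_differentiable f : trigpoly f -> forall x, differentiable f x.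
Proof.
elim=> {f} [c|f cf|f g _ df _ dg|f g _ df _ dg|f _ df|f _ df] x.
- exact: differentiable_cst.
- exact: linear_differentiable.
- exact: differentiableD.
- exact: differentiableM.
- exact/differentiable_comp/differentiable_cos.
- exact/differentiable_comp/differentiable_sin.
Qed.

Lemma derive_compR (f : V -> R) (h : R -> R) v x dh :
  is_derive (f x) 1 h dh -> differentiable f x -> 'D_v (h \o f) x = dh * 'D_v f x.
Proof.
move=> dhx dfx; have dh1 : differentiable h (f x).
  by apply/derivable1_diffP; exact: ex_derive.
rewrite deriveE; last exact: differentiable_comp.
rewrite (diff_comp dfx dh1) [LHS]/comp deriv1E; last exact: ex_derive.
by rewrite derive1E derive_val deriveE // /GRing.scale /= mulrC.
Qed.

Lemma trigpoly_derive v f : trigpoly f -> trigpoly ('D_v f).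
Proof.
elim=> {f} [c|f cf|f g tf df tg dg|f g tf df tg dg|f tf df|f tf df].
- have -> : 'D_v (cst c) = cst (0 : R).
    by apply/funext => x; rewrite derive_cst.
  exact: trigpoly_cst.
- have -> : 'D_v f = cst (f v).
    by apply/funext => x; rewrite deriveE ?diff_lin //; exact: linear_differentiable.
  exact: trigpoly_cst.
- have -> : 'D_v (f + g) = 'D_v f + 'D_v g.
    by apply/funext => x; rewrite deriveD //; apply/diff_derivable/trigpoly_differentiable.
  exact: trigpoly_add.
- have -> : 'D_v (f * g) = f * 'D_v g + g * 'D_v f.
    by apply/funext => x; rewrite deriveM //; apply/diff_derivable/trigpoly_differentiable.
  by apply: trigpoly_add; apply: trigpoly_mul.
- have -> : 'D_v (cos \o f) = (- (sin \o f)) * 'D_v f.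
    by apply/funext => x; rewrite (derive_compR _ (is_derive_cos (f x)));
       [|exact: trigpoly_differentiable].
  by apply/trigpoly_mul/df/trigpoly_opp/trigpoly_sin.
- have -> : 'D_v (sin \o f) = (cos \o f) * 'D_v f.
    by apply/funext => x; rewrite (derive_compR _ (is_derive_sin (f x)));
       [|exact: trigpoly_differentiable].
  by apply/trigpoly_mul/df/trigpoly_cos.
Qed.

(** Finite sums of scalar functions times fixed vectors, which reduces vector-valued smoothness to
    the scalar class. *)
Inductive trigpolyv (W : normedModType R) : (V -> W) -> Prop :=
| trigpolyv0 : trigpolyv (cst 0)
| trigpolyv_add f g : trigpolyv f -> trigpolyv g -> trigpolyv (f + g)
| trigpolyv_scale h w : trigpoly h -> trigpolyv (fun x => h x *: w).

Lemma trigpolyv_differentiable (W : normedModType R) (f : V -> W) :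
  trigpolyv f -> forall x, differentiable f x.
Proof.
elim=> {f} [|f g _ df _ dg|h w th] x.
- exact: differentiable_cst.
- exact: differentiableD.
- exact/differentiableZl/trigpoly_differentiable.
Qed.

Lemma trigpolyv_derive (W : normedModType R) v (f : V -> W) : trigpolyv f -> trigpolyv ('D_v f).
Proof.
elim=> {f} [|f g tf df tg dg|h w th].
- have -> : 'D_v (cst (0 : W)) = cst (0 : W).
    by apply/funext => x; rewrite derive_cst.
  exact: trigpolyv0.
- have -> : 'D_v (f + g) = 'D_v f + 'D_v g.
    by apply/funext => x; rewrite deriveD //; apply/diff_derivable/trigpolyv_differentiable.
  exact: trigpolyv_add.
- have -> : 'D_v (fun x => h x *: w) = (fun x => 'D_v h x *: w).
    apply/funext => x; have dh := trigpoly_differentiable th x.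
    by rewrite deriveE ?diffZl -?deriveE //; exact: differentiableZl.
  exact/trigpolyv_scale/trigpoly_derive.
Qed.

Lemma trigpolyv_smooth (W : normedModType R) (f : V -> W) : trigpolyv f -> smooth_on setT f.
Proof.
move=> tf k; elim: k f tf => [|k IH] f tf /=.
  by move=> x _; apply: differentiable_continuous; exact: trigpolyv_differentiable.
split=> [x _|v]; first exact: trigpolyv_differentiable.
exact/IH/trigpolyv_derive.
Qed.

Lemma trigpolyv_sum (W : normedModType R) (I : Type) (r : seq I) (f : I -> V -> W) :
  (forall i, trigpolyv (f i)) -> trigpolyv (fun x => \sum_(i <- r) f i x).
Proof.
move=> tf; elim: r => [|i r IH].
  by rewrite (_ : (fun _ => _) = cst 0);
    [exact: trigpolyv0|apply/funext => x; rewrite big_nil].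
by rewrite (_ : (fun _ => _) = f i + (fun x => \sum_(i <- r) f i x));
  [exact: trigpolyv_add|apply/funext => x; rewrite big_cons].
Qed.

Definition ctrigpoly (f : V -> R[i]) :=
  trigpoly (fun x => complex.Re (f x)) /\ trigpoly (fun x => complex.Im (f x)).

Lemma ctrigpoly_mul f g : ctrigpoly f -> ctrigpoly g -> ctrigpoly (fun x => f x * g x).
Proof.
move=> [rf jf] [rg jg]; split.
  rewrite (_ : (fun _ => _) = (fun x => complex.Re (f x)) * (fun x => complex.Re (g x))
     + - ((fun x => complex.Im (f x)) * (fun x => complex.Im (g x)))).
    by apply/trigpoly_add/trigpoly_opp; exact: trigpoly_mul.
  apply/funext => x; transitivity (complex.Re (f x) * complex.Re (g x) -
    complex.Im (f x) * complex.Im (g x)) => //.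
  by case: (f x) => a b; case: (g x).
rewrite (_ : (fun _ => _) = (fun x => complex.Re (f x)) * (fun x => complex.Im (g x))
     + ((fun x => complex.Im (f x)) * (fun x => complex.Re (g x)))).
  by apply/trigpoly_add; exact: trigpoly_mul.
apply/funext => x; transitivity (complex.Re (f x) * complex.Im (g x) +
  complex.Im (f x) * complex.Re (g x)) => //.
by case: (f x) => a b; case: (g x).
Qed.

Lemma ctrigpoly_conj f : ctrigpoly f -> ctrigpoly (fun x => conjc (f x)).
Proof.
move=> [rf jf]; split.
  by rewrite (_ : (fun _ => _) = (fun x => complex.Re (f x))) //;
    apply/funext => x; case: (f x).
rewrite (_ : (fun _ => _) = - (fun x => complex.Im (f x))); first exact: trigpoly_opp.
apply/funext => x; transitivity (- complex.Im (f x)) => //.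
by case: (f x).
Qed.

End TrigPoly.

(** * Real coordinates on the chart model *)

Section ModelCoord.
Variables (R : realType) (n : nat).
Implicit Types (i : 'I_2) (j : 'I_n).

Definition mre i j (p : model R n) : R := p.1 i j.
Definition mim i j (p : model R n) : R := p.2 i j.

Fact mre_linear i j : linear (mre i j).
Proof. by move=> a x y; rewrite /mre !mxE. Qed.
Fact mim_linear i j : linear (mim i j).
Proof. by move=> a x y; rewrite /mim !mxE. Qed.
HB.instance Definition _ i j :=
  GRing.isLinear.Build R (model R n) R _ (mre i j) (mre_linear i j).
HB.instance Definition _ i j :=
  GRing.isLinear.Build R (model R n) R _ (mim i j) (mim_linear i j).

Lemma mre_continuous i j : continuous (mre i j).
Proof.
move=> p; apply: (@continuous_comp _ _ _ fst (fun M : 'M[R]_(2, n) => M i j)).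
  exact: cvg_fst.
exact: coord_continuous.
Qed.

Lemma mim_continuous i j : continuous (mim i j).
Proof.
move=> p; apply: (@continuous_comp _ _ _ snd (fun M : 'M[R]_(2, n) => M i j)).
  exact: cvg_snd.
exact: coord_continuous.
Qed.

Lemma model_sum (p : model R n) :
  p = \sum_i \sum_j (mre i j p *: ((delta_mx i j, 0) : model R n) +
                     mim i j p *: ((0, delta_mx i j) : model R n)).
Proof.
have E (q : model R n) : q = (q.1, q.2) by case: q.
have fsts (I : Type) (r : seq I) (F : I -> model R n) :
    (\sum_(i <- r) F i).1 = \sum_(i <- r) (F i).1.
  by elim/big_rec2: _ => //= i x y _ <-.
have snds (I : Type) (r : seq I) (F : I -> model R n) :
    (\sum_(i <- r) F i).2 = \sum_(i <- r) (F i).2.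
  by elim/big_rec2: _ => //= i x y _ <-.
rewrite [LHS]E [RHS]E; congr (_, _).
  rewrite fsts [LHS]matrix_sum_delta; apply: eq_bigr => i _.
  by rewrite fsts; apply: eq_bigr => j _; rewrite /= scaler0 addr0.
rewrite snds [LHS]matrix_sum_delta; apply: eq_bigr => i _.
by rewrite snds; apply: eq_bigr => j _; rewrite /= scaler0 add0r.
Qed.

Lemma trigpolyv_model (V : normedModType R) (f : V -> model R n) :
  (forall i j, trigpoly (fun x => mre i j (f x))) ->
  (forall i j, trigpoly (fun x => mim i j (f x))) -> trigpolyv f.
Proof.
move=> tr ti; rewrite (_ : f = fun x => \sum_i \sum_j (
    mre i j (f x) *: ((delta_mx i j, 0) : model R n) +
    mim i j (f x) *: ((0, delta_mx i j) : model R n))); last first.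
  by apply/funext => x; exact: model_sum.
do 2!(apply: trigpolyv_sum => ?).
apply: (trigpolyv_add (f := fun x => mre _ _ (f x) *: _)
    (g := fun x => mim _ _ (f x) *: _)); exact: trigpolyv_scale.
Qed.

Lemma trigpolyv_model_of (V : normedModType R) (f : V -> 'M[R[i]]_(2, n)) :
  (forall i j, ctrigpoly (fun x => f x i j)) -> trigpolyv (fun x => model_of (f x)).
Proof.
move=> tf; apply: trigpolyv_model => i j.
  by rewrite (_ : (fun _ => _) = fun x => complex.Re (f x i j));
   [case: (tf i j)|apply/funext => x; rewrite /mre mxE].
by rewrite (_ : (fun _ => _) = fun x => complex.Im (f x i j));
   [case: (tf i j)|apply/funext => x; rewrite /mim mxE].
Qed.
End ModelCoord.

(** * The standard action is smooth, effective and holomorphic *)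

Section StdAction.
Variables (R : realType) (n : nat).
Local Notation C := (R[i]).
Implicit Types (t : torus R n.+1) (V : grass2 R n).

Definition unimod (d : 'rV[C]_(n.+2)) := forall k, `|d 0 k| = 1.

Lemma unimod_unit d : unimod d -> diag_unit d.
Proof. by move=> ud k; rewrite -normr_gt0 ud ltr01. Qed.

Lemma std_weight_unimod t : unimod (std_weight t).
Proof.
by move=> k; rewrite mxE; case: unlift => [i|]; rewrite ?torus_norm ?normr1.
Qed.

Lemma std_actionE t V : std_action t V = gact (std_weight t) V.
Proof.
apply: val_inj; rewrite /gact val_insubd /=.
by have := valP (std_action t V); rewrite /= /std_lin => ->.
Qed.

(** Scalar matrices act trivially, so [d] may be divided by its last entry, and the standard torus
    has weight 1 there. *)
Lemma gact_stdE d t : diag_unit d ->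
  (forall i, tval t 0 i = d 0 (lift ord_max i) / d 0 ord_max) ->
  forall V, gact d V = std_action t V.
Proof.
move=> du td V.
rewrite std_actionE -[LHS](gactZ (c := (d 0 ord_max)^-1)) ?invr_eq0 //.
congr gact; apply/rowP => k; rewrite [RHS]mxE.
case: unliftP => [i ->|->]; rewrite mxE; last by rewrite mulVf.
by rewrite td mulrC.
Qed.

Lemma gact_std d : unimod d -> exists t, forall V, gact d V = std_action t V.
Proof.
move=> ud.
have Pt : [forall j, `|(\row_j (d 0 (lift ord_max j) / d 0 ord_max) : 'rV[C]_n.+1) 0 j| == 1].
  by apply/forallP => j; rewrite mxE normrM normfV !ud invr1 mulr1.
exists (Torus Pt); apply: gact_stdE; first exact: unimod_unit.
by move=> i; rewrite /= mxE.
Qed.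

Lemma std_is_action : is_action (@std_action R n).
Proof.
split=> [V|t u V].
  rewrite std_actionE -[RHS](gact_const _ (oner_neq0 _)); congr gact.
  by apply/rowP => k; rewrite !mxE; case: unlift => [i|] //=; rewrite mxE.
rewrite !std_actionE gactM; try exact/unimod_unit/std_weight_unimod.
congr gact; apply/rowP => k; rewrite !mxE; case: unlift => [i|] //=.
  by rewrite mxE.
by rewrite mulr1.
Qed.

Lemma gact_id_const d : (0 < n)%N -> diag_unit d -> (forall V, gact d V = V) ->
  forall k l, d 0 k = d 0 l.
Proof.
move=> hn du fixd k l.
pose s : 'S_(n.+2) := 1%g.
have /cchart_inj e : cchart s (wt s d (const_mx 1)) = cchart s (const_mx 1).
  by rewrite -gact_cchart // fixd.
have lr i j : d 0 (rcol s j) = d 0 (lcol s i).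
  have /matrixP/(_ i j) := e; rewrite !mxE mulr1 => /(congr1 ( *%R^~ (d 0 (lcol s i)))).
  by rewrite mulfVK // mul1r.
suff E k' : d 0 k' = d 0 (lcol s 0) by rewrite !E.
(* Two identity columns are compared through one of the remaining columns, which exists as [n] is
   positive. *)
by move: k'; apply: (@colP _ s) => [i|j] //; rewrite -!(lr _ (Ordinal hn)).
Qed.

Lemma std_effective : (0 < n)%N -> effective (@std_action R n).
Proof.
move=> hn t ft; have dt := unimod_unit (std_weight_unimod t).
have := gact_id_const hn dt; move=> /(_ (fun V => etrans (esym (std_actionE t V)) (ft V))).
move=> e; apply/val_inj/rowP => i; rewrite /= [RHS]mxE.
by have := e (lift ord_max i) ord_max; rewrite !mxE liftK unlift_none.
Qed.

(** In every chart the action is [wt s d], a complex linear map, which is its own differential. *)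
Lemma gact_preserves_J d : diag_unit d -> preserves_J (@gact R n d).
Proof.
move=> du s p; pose g (q : model R n) := model_of (wt s d (model_complex q)).
have lg : linear g.
  move=> a x y; rewrite [RHS]surjective_pairing; congr (_, _); apply/matrixP => i j; rewrite !mxE.
    case: (_ / _) => u v /=; ring.
  case: (_ / _) => u v /=; ring.
have tg : trigpolyv g.
  have tc (c : C) : ctrigpoly (fun _ : model R n => c).
    by split; apply: trigpoly_cst.
  apply: trigpolyv_model_of => i j; rewrite (_ : (fun _ => _) =
    fun x : model R n => d 0 (rcol s j) / d 0 (lcol s i) * (model_complex x i j)).
    apply: ctrigpoly_mul => //; split.
      rewrite (_ : (fun _ => _) = mre i j); last by apply/funext => x; rewrite mxE.
      exact/trigpoly_lin/mre_continuous.
    rewrite (_ : (fun _ => _) = mim i j); last by apply/funext => x; rewrite mxE.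
    exact/trigpoly_lin/mim_continuous.
  by apply/funext => x; rewrite mxE.
pose G : {linear model R n -> model R n} :=
  HB.pack g (GRing.isLinear.Build _ _ _ _ g lg).
have dg x : differentiable G x by exact: trigpolyv_differentiable.
have cg : continuous G by move=> x; exact: differentiable_continuous.
exists s, G; split => //.
- apply/(@nbhs_ballP _ (model R n)); exists 1 => //= q _.
  by rewrite !chartE gact_cchart // /G /= model_ofK.
- move=> v; rewrite !diff_lin // /G /= /g; congr (_, _); apply/matrixP => i j;
    rewrite !mxE; case: (_ / _) => a b /=; ring.
Qed.

Lemma std_preserves_J : action_preserves_J (@std_action R n).
Proof.
move=> t; rewrite (_ : std_action t = gact (std_weight t)).
  exact/gact_preserves_J/unimod_unit/std_weight_unimod.
by apply/funext => V; exact: std_actionE.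
Qed.

(** Turns the quotients of weights into products, since the class [trigpoly] has no inverses. *)
Lemma norm1_inv (z : C) : `|z| = 1 -> z^-1 = conjc z.
Proof.
by move=> z1; rewrite invC_norm z1 expr1n invr1 mul1r.
Qed.

Lemma std_smooth : smooth_action (@std_action R n).
Proof.
move=> a s p; pose T := ('rV[R]_n.+1 * model R n)%type.
exists s, setT, (fun q : T => model_of (wt s (std_weight (torus_exp q.1)) (model_complex q.2))).
split; first by split => //; exact: openT.
  move=> q _; rewrite std_actionE !chartE gact_cchart ?model_ofK //.
  exact/unimod_unit/std_weight_unimod.
apply: trigpolyv_smooth; apply: trigpolyv_model_of => i j.
rewrite (_ : (fun _ => _) = fun q : T => std_weight (torus_exp q.1) 0 (rcol s j) *
   conjc (std_weight (torus_exp q.1) 0 (lcol s i)) * (model_complex q.2 i j)); last first.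
  by apply/funext => x; rewrite mxE norm1_inv // std_weight_unimod.
have tw k : ctrigpoly (fun q : T => std_weight (torus_exp q.1) 0 k).
  case: (unliftP ord_max k) => [k' ->|->]; last first.
    rewrite (_ : (fun _ => _) = fun=> 1); first by split; exact: trigpoly_cst.
    by apply/funext => q; rewrite mxE unlift_none.
  rewrite (_ : (fun _ => _) = fun q : T => cos (q.1 0 k') +i* sin (q.1 0 k')).
    have tk : trigpoly (fun q : T => q.1 0 k').
      have lk : linear (fun q : T => q.1 0 k') by move=> b x y; rewrite /= !mxE.
      apply: trigpoly_linear => // q.
      apply: (@continuous_comp _ _ _ fst (fun M : 'rV[R]_n.+1 => M 0 k')).
        exact: cvg_fst.
      exact: coord_continuous.
    by split; [apply: (trigpoly_cos tk)|apply: (trigpoly_sin tk)].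
  by apply/funext => q; rewrite !mxE liftK mxE.
apply: ctrigpoly_mul; first by apply: ctrigpoly_mul => //; exact: ctrigpoly_conj.
have cs (f : model R n -> R) : continuous f -> continuous (f \o (snd : T -> model R n)).
  by move=> cf x; apply: continuous_comp; [exact: cvg_snd|exact: cf].
split.
  rewrite (_ : (fun _ => _) = mre i j \o snd); last by apply/funext => x; rewrite mxE.
  apply: trigpoly_linear; last exact/cs/mre_continuous.
  by move=> b x y; rewrite /= linearP.
rewrite (_ : (fun _ => _) = mim i j \o snd); last by apply/funext => x; rewrite mxE.
apply: trigpoly_linear; last exact/cs/mim_continuous.
by move=> b x y; rewrite /= linearP.
Qed.

Lemma std_effective_torus_action :
  (0 < n)%N -> effective_torus_action (@std_action R n).
Proof.
move=> hn; split; [exact: std_is_action|exact: std_smooth|exact: std_effective].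
Qed.

End StdAction.

(** * Commutation with the real dilations *)

Section ModelCurves.
Variables (R : realType).

Lemma is_derive_chain (V W : normedModType R) (g : V -> W) (c : R -> V) u dc :
  is_derive u (1 : R) c dc -> differentiable g (c u) ->
  is_derive u (1 : R) (g \o c) ('d g (c u) dc).
Proof.
move=> hc dg; have dcu : differentiable c u by apply/derivable1_diffP; exact: ex_derive.
have dgc : differentiable (g \o c) u by exact: differentiable_comp.
apply: DeriveDef; first exact/derivable1_diffP.
by rewrite deriveE // diff_comp // [LHS]/comp -(deriveE _ dcu) derive_val.
Qed.

Lemma is_derive_scalel (W : normedModType R) (h : R -> R) (w : W) u dh :
  is_derive u (1 : R) h dh -> is_derive u (1 : R) (fun x => h x *: w) (dh *: w).
Proof.
move=> hh; have dhu : differentiable h u by apply/derivable1_diffP; exact: ex_derive.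
have dhw : differentiable (fun x => h x *: w) u by exact: differentiableZl.
apply: DeriveDef; first exact/derivable1_diffP.
by rewrite deriveE // diffZl // -deriveE // derive_val.
Qed.

Lemma is_derive_bigsum (W : normedModType R) (I : Type) (r : seq I)
    (h : I -> R -> W) (dh : I -> W) u :
  (forall i, is_derive u (1 : R) (h i) (dh i)) ->
  is_derive u (1 : R) (fun x => \sum_(i <- r) h i x) (\sum_(i <- r) dh i).
Proof.
move=> hd; elim: r => [|i r IH].
  rewrite big_nil (_ : (fun _ => _) = cst 0); first exact: is_derive_cst.
  by apply/funext => x; rewrite big_nil.
rewrite big_cons (_ : (fun _ => _) = h i + (fun x => \sum_(i <- r) h i x)).
  exact: is_deriveD.
by apply/funext => x; rewrite big_cons.
Qed.

Variable n : nat.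

Lemma is_derive_model (c : R -> model R n) (dc : model R n) u :
  (forall i j, is_derive u (1 : R) (fun x => mre i j (c x)) (mre i j dc)) ->
  (forall i j, is_derive u (1 : R) (fun x => mim i j (c x)) (mim i j dc)) ->
  is_derive u (1 : R) c dc.
Proof.
move=> cr ci; rewrite (model_sum dc) (_ : c = fun x => \sum_i \sum_j (
    mre i j (c x) *: ((delta_mx i j, 0) : model R n) +
    mim i j (c x) *: ((0, delta_mx i j) : model R n))); last first.
  by apply/funext => x; exact: model_sum.
do 2!(apply: is_derive_bigsum => ?).
by apply: is_deriveD; apply: is_derive_scalel.
Qed.

Lemma is_derive_mre (c : R -> model R n) dc u i j : is_derive u (1 : R) c dc ->
  is_derive u (1 : R) (fun x => mre i j (c x)) (mre i j dc).
Proof.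
move=> hc; have dm : differentiable (mre i j) (c u).
  exact/linear_differentiable/mre_continuous.
have := is_derive_chain hc dm; rewrite diff_lin //; exact: mre_continuous.
Qed.

Lemma is_derive_mim (c : R -> model R n) dc u i j : is_derive u (1 : R) c dc ->
  is_derive u (1 : R) (fun x => mim i j (c x)) (mim i j dc).
Proof.
move=> hc; have dm : differentiable (mim i j) (c u).
  exact/linear_differentiable/mim_continuous.
have := is_derive_chain hc dm; rewrite diff_lin //; exact: mim_continuous.
Qed.

End ModelCurves.

(** * Functions and curves with vanishing derivative *)

Section Flat.
Variables (R : realType) (u : R).
Local Notation C := (R[i]).

(** Only the vanishing of derivatives at [u] is recorded: this passes through sums, products,
    conjugates and inverses without computing any derivative. *)
Definition flat (f : R -> C) :=
  is_derive u (1 : R) (fun x => complex.Re (f x)) 0 /\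
  is_derive u (1 : R) (fun x => complex.Im (f x)) 0.

Lemma flat_cst (c : C) : flat (fun _ => c).
Proof. by split; exact: is_derive_cst. Qed.

Lemma flat_add f g : flat f -> flat g -> flat (fun x => f x + g x).
Proof.
move=> [rf jf] [rg jg]; split.
  rewrite (_ : (fun _ => _) = (fun x => complex.Re (f x)) + (fun x => complex.Re (g x))).
    by apply: is_derive_eq; rewrite addr0.
  by apply/funext => x; rewrite -[RHS]/(_ + _); case: (f x); case: (g x).
rewrite (_ : (fun _ => _) = (fun x => complex.Im (f x)) + (fun x => complex.Im (g x))).
  by apply: is_derive_eq; rewrite addr0.
by apply/funext => x; rewrite -[RHS]/(_ + _); case: (f x); case: (g x).
Qed.

Lemma flat_mul f g : flat f -> flat g -> flat (fun x => f x * g x).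
Proof.
move=> [rf jf] [rg jg]; split.
  rewrite (_ : (fun _ => _) = (fun x => complex.Re (f x)) * (fun x => complex.Re (g x))
     - ((fun x => complex.Im (f x)) * (fun x => complex.Im (g x)))).
    by apply: is_derive_eq; rewrite !scaler0 !addr0 subr0.
  apply/funext => x; transitivity (complex.Re (f x) * complex.Re (g x) -
    complex.Im (f x) * complex.Im (g x)) => //.
  by case: (f x) => a b; case: (g x).
rewrite (_ : (fun _ => _) = (fun x => complex.Re (f x)) * (fun x => complex.Im (g x))
     + ((fun x => complex.Im (f x)) * (fun x => complex.Re (g x)))).
  by apply: is_derive_eq; rewrite !scaler0 !addr0.
apply/funext => x; transitivity (complex.Re (f x) * complex.Im (g x) +
  complex.Im (f x) * complex.Re (g x)) => //.
by case: (f x) => a b; case: (g x).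
Qed.

Lemma flat_conj f : flat f -> flat (fun x => conjc (f x)).
Proof.
move=> [rf jf]; split.
  by rewrite (_ : (fun _ => _) = (fun x => complex.Re (f x))) //;
    apply/funext => x; case: (f x).
rewrite (_ : (fun _ => _) = - (fun x => complex.Im (f x))).
  by apply: is_derive_eq; rewrite oppr0.
apply/funext => x; transitivity (- complex.Im (f x)) => //.
by case: (f x).
Qed.

Lemma flat_inv_real (f : R -> R) : f u != 0 -> is_derive u (1 : R) f 0 ->
  is_derive u (1 : R) (fun x => (f x)^-1) 0.
Proof.
move=> f0 df; apply: DeriveDef; first by apply: derivableV => //; exact: ex_derive.
by rewrite deriveV //; rewrite derive_val scaler0.
Qed.

Lemma flat_inv f : f u != 0 -> flat f -> flat (fun x => (f x)^-1).
Proof.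
move=> f0 [rf jf].
pose r x := complex.Re (f x); pose i x := complex.Im (f x).
have [dr di] : is_derive u (1 : R) r 0 /\ is_derive u (1 : R) i 0 by [].
have dN : is_derive u (1 : R) (fun x => (r x ^+ 2 + i x ^+ 2)^-1) 0.
  apply: flat_inv_real.
    apply: contraNneq f0 => /eqP; rewrite paddr_eq0 ?sqr_ge0 // !sqrf_eq0 /r /i.
    by case: (f u) => a b /= /andP[/eqP -> /eqP ->].
  rewrite (_ : (fun _ => _) = r * r + i * i).
    by apply: is_derive_eq; rewrite !scaler0 !addr0.
  by apply/funext => x; rewrite !expr2.
split.
  rewrite (_ : (fun _ => _) = r * (fun x => (r x ^+ 2 + i x ^+ 2)^-1)).
    by apply: is_derive_eq; rewrite !scaler0 !addr0.
  by apply/funext => x; rewrite -[RHS]/(_ * _) /r /i; case: (f x).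
rewrite (_ : (fun _ => _) = - (i * (fun x => (r x ^+ 2 + i x ^+ 2)^-1))).
  by apply: is_derive_eq; rewrite !scaler0 !addr0 oppr0.
by apply/funext => x; rewrite -[RHS]/(- (_ * _)) /r /i; case: (f x).
Qed.

Lemma flat_sum (I : Type) (r : seq I) (f : I -> R -> C) :
  (forall i, flat (f i)) -> flat (fun x => \sum_(i <- r) f i x).
Proof.
move=> ff; elim: r => [|i r IH].
  by rewrite (_ : (fun _ => _) = fun=> 0);
    [exact: flat_cst|apply/funext => x; rewrite big_nil].
by rewrite (_ : (fun _ => _) = (fun x => f i x + \sum_(i <- r) f i x));
  [exact: flat_add|apply/funext => x; rewrite big_cons].
Qed.

Lemma flat_near f g : (\forall x \near u, f x = g x) -> flat f -> flat g.
Proof.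
move=> fg [rf jf]; split.
  apply: (near_eq_is_derive _ rf).
  by near=> x; congr complex.Re; near: x.
apply: (near_eq_is_derive _ jf).
by near=> x; congr complex.Im; near: x.
Unshelve. all: by end_near.
Qed.

Variable n : nat.

(** In a chart the projector entries are rational in the coordinates and their conjugates, with
    nonvanishing denominator. *)
Lemma flat_pluck_proj (V : R -> grass2 R n) s (k : R -> model R n) a b c d :
  (\forall x \near u, V x = chart s (k x)) -> is_derive u (1 : R) k 0 ->
  flat (fun x => pluck_proj (V x) a b c d).
Proof.
move=> Vk dk.
have fB i j : flat (fun x => chart_mx s (model_complex (k x)) i j).
  move: j; apply: (@colP _ s) => j.
    rewrite (_ : (fun _ => _) = fun=> (i == j)%:R); first exact: flat_cst.
    by apply/funext => x; rewrite chart_mxl.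
  rewrite (_ : (fun _ => _) = fun x => mre i j (k x) +i* mim i j (k x)).
    split; first by have := is_derive_mre i j dk; rewrite linear0.
    by have := is_derive_mim i j dk; rewrite linear0.
  by apply/funext => x; rewrite chart_mxr mxE.
have fm i j : flat (fun x => minor2 (chart_mx s (model_complex (k x))) i j).
  apply: flat_add; first exact: flat_mul.
  rewrite (_ : (fun _ => _) = fun x => -1 * (chart_mx s (model_complex (k x)) 0 j *
     chart_mx s (model_complex (k x)) 1 i)).
    by apply: flat_mul; [exact: flat_cst|exact: flat_mul].
  by apply/funext => x; rewrite mulN1r.
have eV x : val (chart s (k x)) = rowspan (chart_mx s (model_complex (k x))) by [].
apply: (@flat_near (fun x => pluck_proj (chart s (k x)) a b c d)).
  by near=> x; congr (pluck_proj _ a b c d); apply/esym; near: x.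
rewrite (_ : (fun _ => _) = fun x =>
  minor2 (chart_mx s (model_complex (k x))) a b *
  conjc (minor2 (chart_mx s (model_complex (k x))) c d) *
  (\sum_i \sum_j minor2 (chart_mx s (model_complex (k x))) i j *
     conjc (minor2 (chart_mx s (model_complex (k x))) i j))^-1).
  apply: flat_mul; first by apply: flat_mul => //; exact: flat_conj.
  apply: flat_inv; first exact: (minor2_sum_neq0 (eV u)).
  do 2!(apply: flat_sum => ?); apply: flat_mul => //; exact: flat_conj.
by apply/funext => x; exact: pluck_projE.
Unshelve. all: by end_near.
Qed.
End Flat.

(* The entries of the Pluecker projector are globally defined and separate
   points, so no comparison of charts along the curve is needed. *)
Lemma flat_constant (R : realType) n (V : R -> grass2 R n) :
  (forall u, exists s k, (\forall x \near u, V x = chart s (k x)) /\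
     is_derive u (1 : R) k (0 : model R n)) -> forall u v, V u = V v.
Proof.
move=> hV u v; apply: pluck_proj_inj => a b c d.
have fl x : flat x (fun x => pluck_proj (V x) a b c d).
  by have [s [k [Vk dk]]] := hV x; exact: flat_pluck_proj Vk dk.
have := @is_derive_0_is_cst _ (fun x => complex.Re (pluck_proj (V x) a b c d)) u v
  (fun x => (fl x).1).
have := @is_derive_0_is_cst _ (fun x => complex.Im (pluck_proj (V x) a b c d)) u v
  (fun x => (fl x).2).
by case: (pluck_proj (V u) a b c d) (pluck_proj (V v) a b c d) => x y [x' y'] /= -> ->.
Qed.

(** * Rotations and dilations in the charts *)

Section Flow.
Variables (R : realType) (n : nat).
Implicit Types (a : 'M[R]_(2, n)) (w : 'I_(n.+2) -> R) (p : model R n).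

(** The one-parameter groups generated by diag(w) and, for [rotw], by i diag(w); only the second
    lies in the compact torus. *)
Definition expw w u : 'rV[R[i]]_(n.+2) := \row_k (expR (w k * u))%:C.
Definition rotw w u : 'rV[R[i]]_(n.+2) := \row_k (cos (w k * u) +i* sin (w k * u)).

(** The velocity at time 0 of [mexp a], while that of [mrot a] is [model_J] of it. *)
Definition mscale a p : model R n := (\matrix_(i, j) (a i j * p.1 i j),
  \matrix_(i, j) (a i j * p.2 i j)).
Definition mexp a u p : model R n := (\matrix_(i, j) (expR (a i j * u) * p.1 i j),
  \matrix_(i, j) (expR (a i j * u) * p.2 i j)).
Definition mrot a u p : model R n :=
  (\matrix_(i, j) (cos (a i j * u) * p.1 i j - sin (a i j * u) * p.2 i j),
   \matrix_(i, j) (cos (a i j * u) * p.2 i j + sin (a i j * u) * p.1 i j)).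
(** The weights of diag(w) on the coordinates of the chart. *)
Definition wdiff (s : 'S_(n.+2)) w : 'M[R]_(2, n) :=
  \matrix_(i, j) (w (rcol s j) - w (lcol s i)).

Lemma mre_mscale a p i j : mre i j (mscale a p) = a i j * mre i j p.
Proof. by rewrite /mre mxE. Qed.

Lemma mim_mscale a p i j : mim i j (mscale a p) = a i j * mim i j p.
Proof. by rewrite /mim mxE. Qed.

Lemma expw_unit w u : diag_unit (expw w u).
Proof. by move=> k; rewrite mxE; apply/eqP => -[/eqP]; rewrite gt_eqF // expR_gt0. Qed.

Lemma rotw_unimod w u : unimod (rotw w u).
Proof. by move=> k; rewrite mxE normc_def /= cos2Dsin2 sqrtr1. Qed.

Lemma gact_expw s w u p :
  gact (expw w u) (chart s p) = chart s (mexp (wdiff s w) u p).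
Proof.
rewrite chartE gact_cchart; last exact: expw_unit.
rewrite chartE; congr cchart; apply/matrixP => i j; rewrite !mxE.
rewrite -fmorphV -rmorphM /= -expRN -expRD.
have -> : w (rcol s j) * u - w (lcol s i) * u = (w (rcol s j) - w (lcol s i)) * u by ring.
by congr (_ +i* _); rewrite mul0r ?subr0 ?addr0.
Qed.

Lemma gact_rotw s w u p :
  gact (rotw w u) (chart s p) = chart s (mrot (wdiff s w) u p).
Proof.
rewrite chartE gact_cchart; last exact/unimod_unit/rotw_unimod.
rewrite chartE; congr cchart; apply/matrixP => i j.
rewrite mxE norm1_inv ?rotw_unimod // !mxE.
have -> : (w (rcol s j) - w (lcol s i)) * u = w (rcol s j) * u - w (lcol s i) * u by ring.
by rewrite cosB sinB /=; congr (_ +i* _); ring.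
Qed.

Lemma is_derive_lin_comp (h : R -> R) (dh c u0 u : R) :
  is_derive (c * (u - u0)) (1 : R) h dh ->
  is_derive u (1 : R) (fun v => h (c * (v - u0))) (dh * c).
Proof.
move=> hd; have hl : is_derive u (1 : R) (fun v => c * (v - u0)) c.
  rewrite (_ : (fun _ => _) = c *: (id - cst u0)); last by apply/funext.
  by apply: is_derive_eq; rewrite subr0 /GRing.scale /= mulr1.
exact: (@is_derive1_comp R h (fun v => c * (v - u0)) u dh c hd hl).
Qed.

Lemma is_derive_mexp a p (u0 : R) :
  is_derive u0 (1 : R) (fun v => mexp a (v - u0) p) (mscale a p).
Proof.
have de i j : is_derive u0 (1 : R) (fun v => expR (a i j * (v - u0))) (a i j).
  apply: (is_derive_eq (is_derive_lin_comp (is_derive_expR _))).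
  by rewrite subrr mulr0 expR0 mul1r.
apply: is_derive_model => i j.
  rewrite (_ : (fun _ => _) = fun v => expR (a i j * (v - u0)) * p.1 i j).
    by rewrite /mre mxE; exact: is_derive_scalel.
  by apply/funext => v; rewrite /mre mxE.
rewrite (_ : (fun _ => _) = fun v => expR (a i j * (v - u0)) * p.2 i j).
  by rewrite /mim mxE; exact: is_derive_scalel.
by apply/funext => v; rewrite /mim mxE.
Qed.

Lemma is_derive_mrot a p :
  is_derive (0 : R) (1 : R) (fun v => mrot a v p) (model_J (mscale a p)).
Proof.
have dc i j : is_derive (0 : R) (1 : R) (fun v => cos (a i j * v)) 0.
  rewrite (_ : (fun _ => _) = fun v => cos (a i j * (v - 0))); last first.
    by apply/funext => v; rewrite subr0.
  apply: (is_derive_eq (is_derive_lin_comp (is_derive_cos _))).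
  by rewrite subrr mulr0 sin0 oppr0 mul0r.
have ds i j : is_derive (0 : R) (1 : R) (fun v => sin (a i j * v)) (a i j).
  rewrite (_ : (fun _ => _) = fun v => sin (a i j * (v - 0))); last first.
    by apply/funext => v; rewrite subr0.
  apply: (is_derive_eq (is_derive_lin_comp (is_derive_sin _))).
  by rewrite subrr mulr0 cos0 mul1r.
apply: is_derive_model => i j.
  rewrite (_ : (fun _ => _) = (fun v => cos (a i j * v) * p.1 i j) -
      (fun v => sin (a i j * v) * p.2 i j)); last first.
    by apply/funext => v; rewrite /mre mxE.
  have d1 := is_derive_scalel (p.1 i j : R) (dc i j).
  have d2 := is_derive_scalel (p.2 i j : R) (ds i j).
  apply: (is_derive_eq (is_deriveB d1 d2)).
  by rewrite scale0r sub0r /mre /= !mxE.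
rewrite (_ : (fun _ => _) = (fun v => cos (a i j * v) * p.2 i j) +
    (fun v => sin (a i j * v) * p.1 i j)); last first.
  by apply/funext => v; rewrite /mim mxE.
have d1 := is_derive_scalel (p.2 i j : R) (dc i j).
have d2 := is_derive_scalel (p.1 i j : R) (ds i j).
apply: (is_derive_eq (is_deriveD d1 d2)).
by rewrite scale0r add0r /mim /= !mxE.
Qed.

Lemma mexp0 a p : mexp a 0 p = p.
Proof.
by case: p => x y; congr (_, _); apply/matrixP => i j; rewrite mxE mulr0 expR0 mul1r.
Qed.

Lemma mrot0 a p : mrot a 0 p = p.
Proof.
case: p => x y; congr (_, _); apply/matrixP => i j; rewrite mxE mulr0 cos0 sin0 mul1r.
  by rewrite mul0r subr0.
by rewrite mul0r addr0.
Qed.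

Lemma chart_inj s : injective (@chart R n s).
Proof.
move=> p q; rewrite !chartE => /cchart_inj e.
by rewrite -[p]model_complexK e model_complexK.
Qed.

Lemma model_J_inj : injective (@model_J R n).
Proof. by move=> [x y] [x' y'] [/oppr_inj -> ->]. Qed.

Lemma gact_expw_addC w u v V :
  gact (expw w u) (gact (expw w v) V) = gact (expw w (u + v)) V.
Proof.
rewrite gactM; try exact: expw_unit.
congr gact; apply/rowP => k; rewrite !mxE mulrDr expRD.
by rewrite rmorphM.
Qed.

Lemma gact_expw0 w V : gact (expw w 0) V = V.
Proof.
rewrite -[RHS](gact_const _ (oner_neq0 _)); congr gact.
by apply/rowP => k; rewrite !mxE mulr0 expR0.
Qed.

Lemma near_curve (c : R -> model R n) (u : R) dc (P : model R n -> Prop) :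
  is_derive u (1 : R) c dc -> (\forall q \near c u, P q) -> \forall v \near u, P (c v).
Proof.
move=> hc; have : {for u, continuous c}.
  by apply/differentiable_continuous/derivable1_diffP; exact: ex_derive.
by move=> cc /cc.
Qed.

Variable F : grass2 R n -> grass2 R n.
Hypothesis FJ : preserves_J F.
Hypothesis FU : forall d V, unimod d -> F (gact d V) = gact d (F V).

(* Rotation equivariance gives [dg (i A p) = i A' (g p)] for the generators [A],
   [A'] of the dilations; complex linearity of [dg] removes the [i]. *)
Lemma diff_mscale s s' (g : model R n -> model R n) p w :
  (\forall q \near p, F (chart s q) = chart s' (g q)) -> differentiable g p ->
  (forall v, 'd g p (model_J v) = model_J ('d g p v)) ->
  'd g p (mscale (wdiff s w) p) = mscale (wdiff s' w) (g p).
Proof.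
move=> nF dg gJ; apply: model_J_inj; rewrite -gJ.
have Fp : F (chart s p) = chart s' (g p) by exact: nbhs_singleton nF.
have dr := is_derive_mrot (wdiff s w) p.
have dgr := @is_derive_chain _ _ _ g _ _ _ dr.
rewrite /= mrot0 in dgr; have {}dgr := dgr dg.
have dr' := is_derive_mrot (wdiff s' w) (g p).
rewrite -(@derive_val _ _ _ _ _ _ _ dgr) -(@derive_val _ _ _ _ _ _ _ dr').
apply: near_eq_derive.
have : \forall v \near (0 : R), F (chart s (mrot (wdiff s w) v p)) =
    chart s' (g (mrot (wdiff s w) v p)).
  by apply: (near_curve dr (P := fun q => F (chart s q) = chart s' (g q))); rewrite mrot0.
apply: filterS => v e; apply: (@chart_inj s'); rewrite /= -e -gact_rotw.
by rewrite FU ?Fp ?gact_rotw //; exact: rotw_unimod.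
Qed.

(** The curve [c] conjugates [F] by the flow. By [diff_mscale] the velocities of the inner and the
    outer flow cancel, so [c] has zero derivative everywhere and is constant. *)
Lemma commutes_expw w u V : F (gact (expw w u) V) = gact (expw w u) (F V).
Proof.
pose c v := gact (expw w (- v)) (F (gact (expw w v) V)).
suff e : c u = c 0.
  have cu : gact (expw w u) (c u) = F (gact (expw w u) V).
    by rewrite /c gact_expw_addC subrr gact_expw0.
  have c0 : c 0 = F V by rewrite /c oppr0 !gact_expw0.
  by rewrite -cu e c0.
apply: flat_constant => u0.
have [s [p eW]] := chart_cover (gact (expw w u0) V).
have [s' [g [nF dg gJ]]] := FJ s p.
have Egp := diff_mscale w nF dg gJ.
have de := is_derive_mexp (wdiff s w) p u0.
(* The inner flow is restarted at time [u0], where it passes through [p]; this keeps it in the chart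
   for [v] near [u0]. *)
exists s', (fun v => mexp (wdiff s' w) (- v) (g (mexp (wdiff s w) (v - u0) p))); split.
  have : \forall v \near u0, F (chart s (mexp (wdiff s w) (v - u0) p)) =
      chart s' (g (mexp (wdiff s w) (v - u0) p)).
    by apply: (near_curve de (P := fun q => F (chart s q) = chart s' (g q))); rewrite subrr mexp0.
  apply: filterS => v e; rewrite /c -gact_expw -e -gact_expw -eW.
  by rewrite gact_expw_addC subrK.
have dge := @is_derive_chain _ _ _ g _ _ _ de.
rewrite /= subrr mexp0 in dge; have {}dge := dge dg; rewrite Egp in dge.
have dx i j : is_derive u0 (1 : R) (fun v => expR (wdiff s' w i j * (- v)))
    (- (wdiff s' w i j) * expR (wdiff s' w i j * - u0)).
  rewrite (_ : (fun _ => _) = fun v => expR ((- wdiff s' w i j) * (v - 0))); last first.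
    by apply/funext => v; rewrite subr0 mulrN mulNr.
  apply: (is_derive_eq (is_derive_lin_comp (is_derive_expR _))).
  rewrite subr0 mulrC; congr (_ * expR _).
  by rewrite mulNr mulrN.
apply: is_derive_model => i j.
  rewrite (_ : (fun _ => _) = (fun v => expR (wdiff s' w i j * (- v))) *
     (fun v => mre i j (g (mexp (wdiff s w) (v - u0) p)))); last first.
    by apply/funext => v; rewrite /mre mxE.
  apply: (is_derive_eq (is_deriveM (dx i j) (is_derive_mre i j dge))).
  rewrite linear0 [X in mre i j X *: _]/= subrr mexp0 mre_mscale /GRing.scale /=; ring.
rewrite (_ : (fun _ => _) = (fun v => expR (wdiff s' w i j * (- v))) *
   (fun v => mim i j (g (mexp (wdiff s w) (v - u0) p)))); last first.
  by apply/funext => v; rewrite /mim mxE.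
apply: (is_derive_eq (is_deriveM (dx i j) (is_derive_mim i j dge))).
rewrite linear0 [X in mim i j X *: _]/= subrr mexp0 mim_mscale /GRing.scale /=; ring.
Qed.

End Flow.

(** * Diagonal form in the charts *)

Section FixedPoints.
Variables (R : realType) (n : nat).
Local Notation C := (R[i]).
Implicit Types (s : 'S_(n.+2)).

Lemma lcol_rcol s i j : (lcol s i == rcol s j) = false.
Proof.
apply/eqP => /perm_inj/(congr1 val) /= e; have := ltn_ord i.
by rewrite e ltnNge leq_addr.
Qed.

Lemma lcol_eq s (i k : 'I_2) : (lcol s i == lcol s k) = (i == k).
Proof.
by apply/eqP/eqP => [e|->//]; apply: (@lshift_inj 2 n); exact: perm_inj e.
Qed.

Lemma rcol_eq s (j l : 'I_n) : (rcol s j == rcol s l) = (j == l).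
Proof.
by apply/eqP/eqP => [e|->//]; apply: (@rshift_inj 2 n); exact: perm_inj e.
Qed.

Lemma wt0 s d : wt s d 0 = 0 :> 'M[C]_(2, n).
Proof. by apply/matrixP => i j; rewrite !mxE mulr0. Qed.

Lemma model_of0 : model_of 0 = 0 :> model R n.
Proof. by congr (_, _); apply/matrixP => i j; rewrite !mxE. Qed.

Lemma model_complex0 : model_complex (0 : model R n) = 0.
Proof. by rewrite -model_of0 model_ofK. Qed.

Lemma gact_chart0 s d : diag_unit d -> gact d (chart s 0) = chart s (0 : model R n).
Proof. by move=> du; rewrite chartE gact_cchart // model_complex0 wt0. Qed.

Definition flip k0 : 'rV[C]_(n.+2) := \row_k (if k == k0 then -1 else 1).

Lemma flip_unimod k0 : unimod (flip k0).
Proof. by move=> k; rewrite mxE; case: eqP; rewrite ?normrN normr1. Qed.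

Lemma opp_self (x : C) : - x = x -> x = 0.
Proof.
move=> /eqP; rewrite eq_sym -subr_eq0 opprK -mulr2n mulrn_eq0 /= => /eqP; exact.
Qed.

(** Flipping the sign of the coordinate [rcol s j] negates column [j] of the chart matrix, so the
    centre is the only torus-fixed point of a chart. *)
Lemma chart_fixed0 s (p : model R n) :
  (forall d, unimod d -> gact d (chart s p) = chart s p) -> p = 0.
Proof.
move=> fp; rewrite -[p]model_complexK -model_of0; congr model_of.
apply/matrixP => i j; rewrite [RHS]mxE; apply: opp_self.
have := fp _ (flip_unimod (rcol s j)).
rewrite chartE gact_cchart; last exact/unimod_unit/flip_unimod.
move/cchart_inj/matrixP/(_ i j); rewrite mxE 2!mxE eqxx.
by rewrite lcol_rcol divr1 mulN1r.
Qed.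

Variables (s s' : 'S_(n.+2)).
Hypothesis ss' : cchart s 0 = cchart s' (0 : 'M[C]_(2, n)).

(** The minor of the coordinate plane at the identity columns of [s] is nonzero, whereas the columns
    of [chart_mx s' 0] outside its own identity block vanish. *)
Lemma lcol_chart0 i : exists i', lcol s i = lcol s' i'.
Proof.
move/(congr1 val): ss'; rewrite !val_cchart => /minor2_rowspan[k e].
have := e (lcol s 0) (lcol s 1); rewrite minor2_chart => e1.
have nz : minor2 (chart_mx s' (0 : 'M[C]_(2, n))) (lcol s 0) (lcol s 1) != 0.
  by apply: contraTneq (oner_neq0 C) => z; rewrite e1 z mulr0 eqxx.
have {nz} : exists i', chart_mx s' (0 : 'M[C]_(2, n)) i' (lcol s i) != 0.
  apply: contrapT => /forallNP z; move/eqP: nz; apply.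
  have {}z i' : chart_mx s' (0 : 'M[C]_(2, n)) i' (lcol s i) = 0.
    by apply/eqP; rewrite -[_ == _]negbK; apply/negP/z.
  rewrite /minor2; move: i z {e e1}; apply: ord2P => z; rewrite !z; ring.
case=> i'; move: (lcol s i); apply: (@colP _ s') => j; first by exists j.
by rewrite chart_mxr mxE eqxx.
Qed.

End FixedPoints.

(** * From homogeneity to linear and diagonal form *)

Section ChartDiag.
Variables (R : realType) (n : nat).
Local Notation C := (R[i]).
Variable F : grass2 R n -> grass2 R n.
Hypothesis FJ : preserves_J F.
Hypothesis FU : forall d V, unimod d -> F (gact d V) = gact d (F V).
Hypothesis F0 : forall s, F (chart s 0) = chart s 0.

Lemma mexp_const1 u (p : model R n) : mexp (const_mx 1) u p = expR u *: p.
Proof. by congr (_, _); apply/matrixP => i j; rewrite !mxE mul1r. Qed.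

(** For 0 < h <= 1, writing h as [expR (ln h)] makes the difference quotient constantly [g q], so
    the one-sided limit identifies the derivative. Exponents [u <= 0] suffice, and they keep the
    points inside a ball around 0. *)
Lemma diff_homogeneous (g : model R n -> model R n) :
  differentiable g 0 -> g 0 = 0 ->
  forall q, (forall u : R, u <= 0 -> g (expR u *: q) = expR u *: g q) -> 'd g 0 q = g q.
Proof.
move=> dg g0 q hq; rewrite -deriveE // /derive.
have /cvg_ex[l cl] := diff_derivable (v := q) dg.
have cr : h^-1 *: (g (h *: q + 0) - g 0) @[h --> (0 : R)^'+] --> l.
  exact: cvg_dnbhs_at_right cl.
rewrite (cvg_lim _ cl) //.
have cc : h^-1 *: (g (h *: q + 0) - g 0) @[h --> (0 : R)^'+] --> g q.
  apply: cvg_near_cst; near=> h.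
  have h0 : 0 < h by [].
  have h1 : h <= 1 by near: h; exact: nbhs_right_le.
  rewrite addr0 g0 subr0 -(lnK h0) hq ?ln_le0 // scalerA mulVf ?scale1r //.
  by rewrite gt_eqF // expR_gt0.
exact: (cvg_unique _ cr cc).
Unshelve. all: by end_near.
Qed.

(** Near the centre, [F] reads as a homogeneous differentiable map, hence as its differential; the
    dilations, which commute with [F], spread this over the whole chart. *)
Lemma chart_linear s : exists s' (L : {linear model R n -> model R n}),
  [/\ cchart s 0 = cchart s' (0 : 'M[C]_(2, n)),
      forall v, L (model_J v) = model_J (L v) &
      forall q, F (chart s q) = chart s' (L q)].
Proof.
have [s' [g [nF dg gJ]]] := FJ s 0.
have e0 : chart s' (g 0) = chart s 0 by rewrite -F0; exact/esym/(nbhs_singleton nF).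
(* The centre is fixed by [F], so [g 0] represents a torus-fixed point of the chart [s']. *)
have g0 : g 0 = 0.
  apply: (@chart_fixed0 _ _ s') => d ud; rewrite e0 gact_chart0 //.
  exact: unimod_unit.
have ss' : cchart s 0 = cchart s' (0 : 'M[C]_(2, n)).
  by move: e0; rewrite g0 !chartE model_complex0.
have col_l i : exists i', lcol s i = lcol s' i' by exact: (lcol_chart0 ss').
have col_l' i : exists i', lcol s' i = lcol s i' by exact: (lcol_chart0 (esym ss')).
(* The weights [0] on the columns of the identity block and [1] elsewhere turn
   the flow into the dilations of the chart. *)
pose w k : R := (~~ [exists i, k == lcol s i])%:R.
have wl i : w (lcol s i) = 0.
  by rewrite /w (_ : [exists _, _] = true) //; apply/existsP; exists i.
have wr j : w (rcol s j) = 1.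
  rewrite /w (_ : [exists _, _] = false) //; apply/negbTE/existsPn => i.
  by rewrite eq_sym lcol_rcol.
have wl' i : w (lcol s' i) = 0 by have [i' ->] := col_l' i.
have wr' j : w (rcol s' j) = 1.
  rewrite /w (_ : [exists _, _] = false) //; apply/negbTE/existsPn => i.
  by have [i' ->] := col_l i; rewrite eq_sym lcol_rcol.
have dil u q : gact (expw w u) (chart s q) = chart s (expR u *: q).
  rewrite gact_expw -mexp_const1; congr (chart s (mexp _ u q)).
  by apply/matrixP => i j; rewrite !mxE wl wr subr0.
have dil' u q : gact (expw w u) (chart s' q) = chart s' (expR u *: q).
  rewrite gact_expw -mexp_const1; congr (chart s' (mexp _ u q)).
  by apply/matrixP => i j; rewrite !mxE wl' wr' subr0.
have FE u V : F (gact (expw w u) V) = gact (expw w u) (F V) by exact: commutes_expw.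
have /nbhs_normP[e /= e_gt0 nFe] := nF.
have nFe' q : `|q| < e -> F (chart s q) = chart s' (g q).
  by move=> qe; apply: nFe; rewrite /ball_ /= sub0r normrN.
have gL q : `|q| < e -> 'd g 0 q = g q.
  move=> qe; apply: diff_homogeneous => // u u0.
  apply: (@chart_inj _ _ s'); rewrite -dil' -!nFe' ?dil ?FE //; last first.
    rewrite normrZ (le_lt_trans _ qe) // ler_piMl // gtr0_norm ?expR_gt0 //.
    by rewrite -expR0 ler_expR.
  by rewrite -dil FE.
exists s', ('d g 0); split=> // q.
have q1 : 0 < `|q| + 1 by rewrite ltr_wpDl.
(* A flow time that brings [q] into the ball of radius [e]; the summand 1 covers [q = 0] and makes
   the bound strict. *)
pose u := ln (e / (`|q| + 1)).
have eu : expR u = e / (`|q| + 1) by rewrite lnK // posrE divr_gt0.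
have qe : `|expR u *: q| < e.
  rewrite normrZ gtr0_norm ?expR_gt0 // eu mulrAC ltr_pdivrMr // ltr_pM2l //.
  by rewrite ltrDl.
have := nFe' _ qe; rewrite -gL // -dil FE linearZ /= -dil'.
move/(congr1 (gact (expw w (- u)))); rewrite !gact_expw_addC addNr.
by rewrite !gact_expw0.
Qed.

(** Commutation with J upgrades real to complex linearity. The charts [s] and [s'] share their
    centre, so they differ only in the order of the columns and [s] can replace [s']. *)
Lemma chart_clinear s : exists N : 'M[C]_(2, n) -> 'M[C]_(2, n),
  (forall a Y Z, N (a *: Y + Z) = a *: N Y + N Z) /\
  forall Z, F (cchart s Z) = cchart s (N Z).
Proof.
have [s' [L [ss' LJ FL]]] := chart_linear s.
pose LC Z := model_complex (L (model_of Z)).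
have LClin a Y Z : LC (a *: Y + Z) = a *: LC Y + LC Z.
  case: a => x y; rewrite /LC.
  have -> : model_of ((x +i* y) *: Y + Z) =
      x *: model_of Y + y *: model_J (model_of Y) + model_of Z.
    congr (_, _); apply/matrixP => i j; rewrite !mxE;
      case: (Y i j) (Z i j) => a b [c d] /=; ring.
  rewrite !linearD !linearZ /= LJ; apply/matrixP => i j; rewrite !mxE.
  by congr (_ +i* _); rewrite /=; ring.
have FLC Z : F (cchart s Z) = cchart s' (LC Z).
  by rewrite -[Z in LHS]model_ofK -chartE FL chartE.
pose N Z := chart_coord s (chart_mx s' (LC Z)).
have [l0 el0] := lcol_chart0 ss' 0; have [l1 el1] := lcol_chart0 ss' 1.
exists N; split.
  move=> a Y Z; apply/matrixP => i j.
  have [j' ej] : exists j', rcol s j = rcol s' j'.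
    have : forall i', rcol s j != lcol s' i'.
      move=> i'; have [k ->] := lcol_chart0 (esym ss') i'.
      by rewrite eq_sym lcol_rcol.
    move: (rcol s j); apply: (@colP _ s') => k nk; last by exists k.
    by have := nk k; rewrite eqxx.
  (* The denominator is a minor of identity columns, independent of Z, and each numerator has one
     column of Z, so the coordinate change is linear. *)
  rewrite /N /chart_coord LClin !mxE /minor2 el0 el1 ej !chart_mxl !chart_mxr !mxE.
  by case: (i == 0); ring.
move=> Z; rewrite FLC; apply: eq_cchart => //.
have := congr1 val ss'; rewrite !val_cchart => /minor2_rowspan[k e].
have := e (lcol s 0) (lcol s 1); rewrite minor2_chart {e} => e.
apply: contraTneq (oner_neq0 C) => z; rewrite e -(mulr0 k) -z.
by rewrite /minor2 el0 el1 !chart_mxl eqxx.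
Qed.

(** The matrix units are eigenvectors of the torus with distinct characters, so a linear map
    commuting with the torus is diagonal on them. *)
Lemma chart_diag s : exists c : 'M[C]_(2, n),
  forall Z, F (cchart s Z) = cchart s (\matrix_(i, j) (c i j * Z i j)).
Proof.
have [N [Nlin FN]] := chart_clinear s.
have Nwt d Z : unimod d -> N (wt s d Z) = wt s d (N Z).
  move=> ud; apply: (@cchart_inj _ _ s); have du := unimod_unit ud.
  by rewrite -FN -!gact_cchart // FU // FN.
have N0 : N 0 = 0.
  by have := Nlin (-1) 0 0; rewrite scaler0 addr0 scaleN1r addNr.
have Noff i j i' j' : (i, j) != (i', j') -> N (delta_mx i j) i' j' = 0.
  move=> ne; have E d : unimod d -> d 0 (rcol s j) / d 0 (lcol s i) * N (delta_mx i j) i' j' =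
      d 0 (rcol s j') / d 0 (lcol s i') * N (delta_mx i j) i' j'.
    move=> ud; have := Nwt d (delta_mx i j) ud.
    have -> : wt s d (delta_mx i j) = (d 0 (rcol s j) / d 0 (lcol s i)) *: delta_mx i j + 0.
      rewrite addr0; apply/matrixP => k l; rewrite !mxE.
      by case: eqP => [->|_]; case: eqP => [->|_]; rewrite ?mulr0.
    by rewrite Nlin N0 addr0 => /matrixP/(_ i' j'); rewrite !mxE.
  (* One sign change separates the two characters: at [lcol s i] if only the rows differ, at
     [rcol s j] if the columns differ. *)
  apply: opp_self; have [ej|nj] := eqVneq j j'.
    have ni : i' != i by apply: contraNneq ne => ->; rewrite ej.
    have := E _ (flip_unimod R (lcol s i)); rewrite !mxE ![rcol s _ == _]eq_sym !lcol_rcol !lcol_eq eqxx.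
    by rewrite (negPf ni) invrN invr1 !mul1r mulN1r.
  have := E _ (flip_unimod R (rcol s j)); rewrite !mxE !lcol_rcol !rcol_eq eqxx eq_sym.
  by rewrite (negPf nj) !divr1 mulN1r mul1r.
exists (\matrix_(i, j) N (delta_mx i j) i j) => Z; rewrite FN; congr cchart.
have Nsum (I : Type) (r : seq I) (f : I -> 'M[C]_(2, n)) :
    N (\sum_(k <- r) f k) = \sum_(k <- r) N (f k).
  elim: r => [|k r IH]; first by rewrite !big_nil.
  by rewrite !big_cons -[f k]scale1r Nlin IH !scale1r.
apply/matrixP => i j; rewrite {1}[Z]matrix_sum_delta Nsum summxE !mxE.
rewrite (bigD1 i) //= Nsum summxE (bigD1 j) //= -[_ *: _]addr0 Nlin N0 addr0 mxE.
rewrite big1 => [|l nl]; last first.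
  rewrite -[_ *: _]addr0 Nlin N0 addr0 mxE Noff ?mulr0 //.
  by apply: contraNneq nl => -[->].
rewrite big1 => [|k nk]; last first.
  rewrite Nsum summxE big1 // => l _; rewrite -[_ *: _]addr0 Nlin N0 addr0 mxE Noff ?mulr0 //.
  by apply: contraNneq nk => -[->].
by rewrite !addr0 mulrC.
Qed.

End ChartDiag.

(** * Involutions *)

Section Involution.
Variables (R : realType) (n : nat).
Local Notation C := (R[i]).
Variable F : grass2 R n -> grass2 R n.
Hypothesis Fdiag : forall s, exists c : 'M[C]_(2, n),
  forall Z, F (cchart s Z) = cchart s (\matrix_(i, j) (c i j * Z i j)).
Hypothesis FF : involutive F.

Lemma involution_diag_sign s (c : 'M[C]_(2, n)) i j :
  (forall Z, F (cchart s Z) = cchart s (\matrix_(i, j) (c i j * Z i j))) ->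
  c i j * c i j = 1.
Proof.
move=> Fc; have := FF (cchart s (const_mx 1)); rewrite !Fc.
by move/cchart_inj/matrixP/(_ i j); rewrite !mxE mulr1.
Qed.

(* [F] preserves every chart, hence the vanishing of each Pluecker coordinate;
   those of the blocks of the constant matrix vanish. *)
Lemma involution_diag_rank1 s (c : 'M[C]_(2, n)) j m :
  (forall Z, F (cchart s Z) = cchart s (\matrix_(i, j) (c i j * Z i j))) ->
  c 0 j * c 1 m = c 0 m * c 1 j.
Proof.
move=> Fc; have [->//|jm] := eqVneq j m; apply/eqP; rewrite -subr_eq0.
apply/negPn/negP => nz.
have rjm : rcol s j != rcol s m.
  by rewrite rcol_eq.
have [s' [e0 e1]] := perm_pair rjm.
have F1 : F (cchart s (const_mx 1)) = cchart s c.
  by rewrite Fc; congr cchart; apply/matrixP => i k; rewrite !mxE mulr1.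
have [c' Fc'] := Fdiag s'.
(* A nonzero minor puts the image of the constant matrix in the chart [s']; applying [F] again stays
   there, yet returns to a plane whose minor at these columns is 0. *)
have e : cchart s c = cchart s' (chart_coord s' (chart_mx s c)).
  by apply: eq_cchart => //; rewrite e0 e1 /minor2 !chart_mxr.
have := congr1 val (FF (cchart s (const_mx 1))); rewrite F1 e Fc' !val_cchart.
move=> /minor2_rowspan[k ek]; have := ek (lcol s' 0) (lcol s' 1).
rewrite minor2_chart e0 e1 /minor2 !chart_mxr !mxE mulr1 subrr mulr0 => /eqP.
by rewrite oner_eq0.
Qed.

(* The span of (1, ..., 1) and (0, 1, ..., n + 1), whose Pluecker coordinates are
   the differences [l - k]. *)
Lemma generic_plane : exists V : grass2 R n, forall s, exists2 Z,
  V = cchart s Z & forall i j, Z i j != 0.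
Proof.
pose B : 'M[C]_(2, n.+2) := \matrix_(i, k) (if i == 0 then 1 else (k : nat)%:R).
have nz a b : a != b -> minor2 B a b != 0.
  move=> ab; rewrite /minor2 !mxE /= !mul1r subr_eq0 eqr_nat.
  by apply: contraNneq ab => /val_inj ->.
have lne (s : 'S_(n.+2)) : lcol s 0 != lcol s 1.
  by rewrite lcol_eq.
pose V := cchart 1%g (chart_coord 1%g B).
have eV : val V = rowspan B by rewrite val_cchart -rowspan_chart // nz.
exists V => s; exists (chart_coord s B); first by apply: eq_cchart => //; exact: nz.
move=> i j; rewrite mxE mulf_neq0 ?invr_eq0 ?nz //.
by case: (i == 0); rewrite nz // ?lcol_rcol // eq_sym lcol_rcol.
Qed.

(** In one chart the sign matrix has rank one and so comes from some [d]; a plane lying in all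
    charts with nonzero coordinates carries the equality over to the others. *)
Lemma involution_gact : (0 < n)%N -> exists d : 'rV[C]_(n.+2),
  (forall k, d 0 k * d 0 k = 1) /\ forall V, F V = gact d V.
Proof.
move=> hn; pose j0 := Ordinal hn; pose s : 'S_(n.+2) := 1%g.
have [c Fc] := Fdiag s.
have c2 i j := involution_diag_sign i j Fc.
have c1 j m := involution_diag_rank1 j m Fc.
(* Solves [c i j = d (rcol s j) / d (lcol s i)], normalised to 1 at [lcol s 0]; row 0 gives the
   entries at [rcol], and column [j0] the one at [lcol s 1]. *)
pose d : 'rV[C]_(n.+2) := \row_k
  match @fintype.split 2 n (s k) with
  | inl i => if i == 0 then 1 else c 0 j0 * c 1 j0
  | inr j => c 0 j
  end.
have dl i : d 0 (lcol s i) = if i == 0 then 1 else c 0 j0 * c 1 j0.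
  by rewrite mxE permKV (unsplitK (inl i : 'I_2 + 'I_n)).
have dr j : d 0 (rcol s j) = c 0 j.
  by rewrite mxE permKV (unsplitK (inr j : 'I_2 + 'I_n)).
have d2 k : d 0 k * d 0 k = 1.
  move: k; apply: (@colP _ s) => [i|j]; last by rewrite dr c2.
  by rewrite dl; case: eqP => _; rewrite ?mulr1 // mulrACA !c2 mulr1.
have du : diag_unit d.
  by move=> k; apply: contraTneq (oner_neq0 C) => z; rewrite -(d2 k) z mulr0 eqxx.
exists d; split=> // V.
have Fs Z : F (cchart s Z) = gact d (cchart s Z).
  rewrite Fc gact_cchart //; congr cchart; apply/matrixP => i j; rewrite [LHS]mxE [RHS]mxE.
  congr (_ * _).
  rewrite dl dr; move: i; apply: ord2P; rewrite /= ?divr1 //.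
  have nz : c 0 j0 * c 1 j0 != 0 by have := du (lcol s 1); rewrite dl.
  apply: (mulIf nz); rewrite divfK // mulrA [c 1 j * _]mulrC -c1 -mulrA c2 mulr1.
  by [].
(* Both maps are diagonal in the chart [s1]; comparing them at [V0], where they agree, allows
   cancelling its nonzero coordinates. *)
have [V0 genV] := generic_plane; have [s1 [Z ->]] := cchart_cover V.
have [c' Fc'] := Fdiag s1; have [Z0 eV0 nz0] := genV s1.
have : F V0 = gact d V0 by have [Y -> _] := genV s; exact: Fs.
rewrite {}eV0 Fc' gact_cchart // => /cchart_inj/matrixP e.
rewrite Fc' gact_cchart //; congr cchart; apply/matrixP => i j; rewrite [LHS]mxE [RHS]mxE.
by congr (_ * _); apply: (mulIf (nz0 i j)); have := e i j; rewrite [LHS]mxE [RHS]mxE.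
Qed.

End Involution.

(** * Extensions of the standard action *)

Section SignElements.
Variable R : realType.

Fact sign_torus_subproof l (b : {ffun 'I_l -> bool}) :
  [forall j, `|(\row_j (-1) ^+ b j : 'rV[R[i]]_l) 0 j| == 1].
Proof. by apply/forallP => j; rewrite mxE normrX normrN1 expr1n. Qed.

Definition sign_torus l b : torus R l := Torus (@sign_torus_subproof l b).

Lemma sign_torusM l b : (sign_torus b * sign_torus b)%g = 1%g :> torus R l.
Proof.
by apply/val_inj/rowP => j; rewrite /= !mxE -expr2 sqrr_sign.
Qed.

Lemma sign_torus_inj l : injective (@sign_torus l).
Proof.
move=> b b' e; apply/ffunP => j; apply: (@signr_inj R[i]).
by have := congr1 (fun t => tval t 0 j) e; rewrite !mxE.
Qed.

(** Places the 2-torsion on one-parameter subgroups, as [action_fixed] requires. *)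
Lemma sign_torus_exp l (b : {ffun 'I_l -> bool}) :
  sign_torus b = torus_exp (\row_j (pi *+ b j)).
Proof.
apply/val_inj/rowP => j; rewrite /= !mxE; case: (b j).
  by rewrite mulr1n cospi sinpi expr1; apply/eqP; rewrite eq_complex /= oppr0 !eqxx.
by rewrite mulr0n cos0 sin0 expr0.
Qed.

Lemma torus_exp0 l : torus_exp 0 = 1%g :> torus R l.
Proof. by apply/val_inj/rowP => j; rewrite /= !mxE cos0 sin0. Qed.

Lemma torus_mulC l (t u : torus R l) : (t * u)%g = (u * t)%g.
Proof. by apply/val_inj/rowP => j; rewrite /= !mxE mulrC. Qed.

End SignElements.

Section Extension.
Variables (R : realType) (n l : nat) (phi : torus R l -> grass2 R n -> grass2 R n).
Hypothesis n_gt0 : (0 < n)%N.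
Hypothesis phi_eff : effective_torus_action phi.
Hypothesis phi_J : action_preserves_J phi.
Variable iota : {multiplicative torus R n.+1 -> torus R l}.
Hypothesis phi_std : forall t x, phi (iota t) x = std_action t x.

(** A unimodular diagonal matrix acts as an element of the standard torus, hence through [iota], and
    the big torus is abelian. *)
Lemma action_unimod t d V : unimod d -> phi t (gact d V) = gact d (phi t V).
Proof.
have [[_ phiM] _ _] := phi_eff.
move=> /gact_std[u du]; rewrite !du -!phi_std -!phiM.
by rewrite torus_mulC.
Qed.

(* Along a one-parameter subgroup the image of a fixed point of the standard
   action stays a fixed point, and those are isolated. *)
Lemma action_fixed a s : phi (torus_exp a) (chart s 0) = chart s 0.
Proof.
have [[phi1 phiM] phiS _] := phi_eff.
pose x u := phi (torus_exp (u *: a)) (chart s 0).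
have xfix u d : unimod d -> gact d (x u) = x u.
  by move=> ud; rewrite -action_unimod // gact_chart0 //; exact: unimod_unit.
suff : x 1 = x 0 by rewrite /x scale1r scale0r torus_exp0 phi1.
apply: flat_constant => u.
have [s' [U [g [[oU Ua] gU _]]]] := phiS (u *: a) s 0.
(* In a chart around [x u], nearby points of the curve are torus-fixed and therefore all sit at the
   centre. *)
exists s', (cst 0); split; last exact: is_derive_cst.
have [[A B] [/= nA nB] AB] : nbhs ((u *: a, 0) : 'rV[R]_l * model R n) U.
  exact: open_nbhs_nbhs.
have : \forall v \near u, U (v *: a, 0).
  have uA : \forall v \near u, A (v *: a) by exact: (@scalel_continuous _ _ a u A nA).
  apply: filterS uA => v Av; apply: AB; split => //=.
  exact: nbhs_singleton nB.
apply: filterS => v Uv; have e := gU _ Uv; rewrite /x /= in e *.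
rewrite e; congr chart; apply: (@chart_fixed0 _ _ s') => d ud.
by rewrite -e xfix.
Qed.

(** The involution given by a 2-torsion element is a diagonal sign matrix, that is, a 2-torsion
    element of the standard torus; effectiveness turns equality of the maps into equality in the big
    torus. *)
Lemma sign_extension b : exists b', sign_torus R b = iota (sign_torus R b').
Proof.
have [[phi1 phiM] phiS phiE] := phi_eff.
set t := sign_torus R b.
have [d [d2 dE]] : exists d : 'rV[R[i]]_(n.+2),
    (forall k, d 0 k * d 0 k = 1) /\ forall V, phi t V = gact d V.
  apply: involution_gact => // [s|V]; last by rewrite -phiM sign_torusM phi1.
  apply: chart_diag => [||s'].
  - exact: phi_J.
  - by move=> d V; exact: action_unimod.
  - by rewrite /t sign_torus_exp action_fixed.
have sgn k : d 0 k = (-1) ^+ (d 0 k != 1).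
  have /eqP := d2 k; rewrite -expr2 sqrf_eq1.
  by case: eqP => [->|_ /eqP ->].
have du : diag_unit d by move=> k; rewrite sgn signr_eq0.
(* Exclusive or of the sign exponents is division by the last sign, which normalises the last weight
   to 1. *)
pose b' := [ffun i : 'I_n.+1 => (d 0 (lift ord_max i) != 1) (+) (d 0 ord_max != 1)].
exists b'; have tE V : phi t V = phi (iota (sign_torus R b')) V.
  rewrite phi_std dE; apply: gact_stdE => // i.
  have dV : (d 0 ord_max)^-1 = d 0 ord_max.
    by apply: (mulIf (du ord_max)); rewrite mulVf // d2.
  by rewrite /= mxE ffunE signr_addb -!sgn dV.
have /phiE e : forall V, phi ((iota (sign_torus R b'))^-1 * t)%g V = V.
  by move=> V; rewrite phiM tE -phiM mulVg phi1.
by rewrite -[LHS](mulKVg (iota (sign_torus R b'))) e mulg1.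
Qed.

(** Counting 2-torsion: distinct sign vectors of length [l] come from distinct ones of length
    [n.+1], so 2^l <= 2^(n+1). *)
Lemma extension_rank : (l <= n.+1)%N.
Proof.
have [f fE] := choice sign_extension.
have finj : injective f.
  by move=> b c e; apply: (@sign_torus_inj R); rewrite !fE e.
have := leq_card _ finj; rewrite !card_ffun !card_bool !card_ord.
by rewrite leq_exp2l.
Qed.

End Extension.

Theorem proposition1p5 (R : realType) (n : nat) (hn : (1 <= n)%N) :
  [/\ effective_torus_action (@std_action R n),
      action_preserves_J (@std_action R n) &
      ~ exists (l : nat) (phi : torus R l -> grass2 R n -> grass2 R n),
          [/\ (n.+1 < l)%N, effective_torus_action phi,
              action_preserves_J phi & extends phi (@std_action R n)]].
Proof.
split; [exact: std_effective_torus_action|exact: std_preserves_J|].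
move=> [l [phi [nl phiE phiJ [iota [_ phi_std]]]]].
by have := extension_rank hn phiE phiJ phi_std; rewrite leqNgt nl.
Qed.
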